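(* Let $f\in F_0(G)$, let $(f_t)$ be the interacting particle system started from $f$, and set $\bar f(\xi,t)=\mathbb E_f f_t(\xi)$ for $\xi\in V\cup E$, $t\ge0$. Then for each $\xi$, $t\mapsto\bar f(\xi,t)$ is differentiable and $$\frac{d}{dt}\bar f(\xi,t)=\big(\mathcal L_G\bar f(\cdot,t)\big)(\xi)\quad(\xi\in V_0\cup E,\ t\ge0),\qquad \bar f(\xi,0)=f(\xi)\ (\xi\in V\cup E),\qquad \bar f(x,t)=f(x)\ (x\in V_1,\ t\ge0).$$ Explicitly: $\frac{d}{dt}\mathbb E_f f_t(x)=\sum_{y\sim x}k_{xy}\,e_{xy}\cdot\mathbb E_f f_t(\langle x,y\rangle)$ for $x\in V_0$, and $\frac{d}{dt}\mathbb E_f f_t(\langle x,y\rangle)\cdot e_{xy}=\frac{\mathbb E_f f_t(y)}{m_y}-\frac{\mathbb E_f f_t(x)}{m_x}$ for $\langle x,y\rangle\in E$.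
   Context: A graph is a quadruple $G=(V,E,K,m)$: $V$ is a finite or countable set of nodes, which are elements of a real Hilbert space $\mathcal H$ with inner product ''$\cdot$'' and norm $|\cdot|$; $E$ is a set of undirected edges (at most one edge between any two distinct nodes, no self-loops); the edge between $x$ and $y$ is written $\langle x,y\rangle=\langle y,x\rangle$, and $y\sim x$ means this edge exists; $K=(k_{xy})_{x,y\in V}$ with $k_{xy}=k_{yx}\ge0$ and $k_{xy}=0$ if there is no edge; $m=(m_x)_{x\in V}$ with $m_x>0$. Let $e_{xy}=(y-x)/|y-x|$. Assume $d_0=\sup_{x\in V}\#\{y:y\sim x\}<\infty$, set $d=\max\{d_0,2\}$, and assume $M=\max\{\sup_{x\in V}m_x^{-1},\sup_{\langle x,y\rangle\in E}k_{xy}\}<\infty$. $V=V_0\cup V_1$ is a fixed partition into disjoint sets. $F(G)$ is the set of functions $f$ assigning a real number $f(x)$ to each $x\in V$ and a vector $f(\langle x,y\rangle)\in\mathcal H$ that is a real multiple of $y-x$ to each edge. For $1\le\alpha<\infty$, $\|f\|_\alpha=\big(\sum_{x\in V}|f(x)|^\alpha/m_x+\sum_{\langle x,y\rangle\in E}k_{xy}|f(\langle x,y\rangle)|^\alpha\big)^{1/\alpha}$, and $\|f\|_\infty=\max\{\sup_x|f(x)|,\sup_{\langle x,y\rangle}|f(\langle x,y\rangle)|\}$. $F_0(G)$ is the set of $f\in F(G)$ with finitely many nonzero values such that $|f(x)|\in\mathbb Z$ and $|f(\langle x,y\rangle)|\in\mathbb Z$ for all nodes and edges. The operator $\mathcal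 L_G:F(G)\to F(G)$ is $(\mathcal L_Gf)(x)=\sum_{y\sim x}k_{xy}\,e_{xy}\cdot f(\langle x,y\rangle)$ for $x\in V$ and $(\mathcal L_Gf)(\langle x,y\rangle)=\big(f(y)/m_y-f(x)/m_x\big)e_{xy}$ for $\langle x,y\rangle\in E$. The interacting particle system (IPS) $(f_t)_{t\ge0}$ is the continuous-time Markov jump process on $F_0(G)$ with the following transitions from state $f$: (i) for each $x\in V$, at rate $|f(x)|/m_x$, for every $y\sim x$ the edge value $f(\langle x,y\rangle)$ is replaced by $f(\langle x,y\rangle)+\mathrm{sgn}(f(x))\,e_{yx}$ (all other values unchanged); (ii) for each edge $\langle x,y\rangle$, at rate $k_{xy}|f(\langle x,y\rangle)|$, with $s=\mathrm{sgn}(f(\langle x,y\rangle)\cdot e_{xy})$, the value $f(x)$ is replaced by $f(x)+s$ if $x\in V_0$ and $f(y)$ by $f(y)-s$ if $y\in V_0$ (values at nodes of $V_1$ never change; this rule is symmetric in $x,y$). $P_f,\mathbb E_f$ denote probability and expectation given $f_0=f$. *)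

(* Defs.v *)
From HB Require Import structures.
From mathcomp Require Import all_boot all_order all_algebra.
From mathcomp Require Import all_classical all_reals all_analysis.
Set Implicit Arguments. Unset Strict Implicit. Unset Printing Implicit Defensive.
Import Order.TTheory GRing.Theory Num.Theory.
Import numFieldNormedType.Exports.
Local Open Scope classical_set_scope.
Local Open Scope ring_scope.

Definition is_hilbert_inner (R : realType) (H : completeNormedModType R)
    (dot : H -> H -> R) : Prop :=
  [/\ (forall u v, dot u v = dot v u),
      (forall a u v w, dot (a *: u + v) w = a * dot u w + dot v w),
      (forall u, 0 <= dot u u),
      (forall u, dot u u = 0 -> u = 0)
    & (forall u, `|u| = Num.sqrt (dot u u))].

Section IPS.
Variables (R : realType) (H : completeNormedModType R) (dot : H -> H -> R).
Variables (V : countType) (pt : V -> H).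
Variable nbrs : V -> seq V.
Variables (k : V -> V -> R) (m : V -> R).
Variable V0 : pred V.   (* V1 is the complement of V0 *)

Definition adj (x y : V) : bool := y \in nbrs x.

Definition evec (x y : V) : H := `|pt y - pt x|^-1 *: (pt y - pt x).

Definition graph_ok : Prop :=
  injective pt /\
      (forall x, uniq (nbrs x)) /\
      (forall x, ~~ adj x x) /\
      (forall x y, adj x y = adj y x) /\
      (exists D : nat, forall x, (size (nbrs x) <= D)%N) /\
      (forall x y, k x y = k y x /\ 0 <= k x y) /\
      (forall x y, ~~ adj x y -> k x y = 0) /\
      (forall x, 0 < m x) /\
      (exists M : R, (forall x, (m x)^-1 <= M) /\
                     (forall x y, adj x y -> k x y <= M)).

(* An element of F(G): a real value at each node, and a vector value at
   each edge, stored symmetrically (value at <x,y> = s.2 x y = s.2 y x);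
   entries at non-adjacent pairs are set to 0. *)
Definition state := ((V -> R) * (V -> V -> H))%type.

Definition in_F (g : state) : Prop :=
  (forall x y, g.2 x y = g.2 y x) /\
  (forall x y, ~~ adj x y -> g.2 x y = 0) /\
  (forall x y, adj x y -> exists a : R, g.2 x y = a *: (pt y - pt x)).

Definition in_F0 (g : state) : Prop :=
  [/\ in_F g,
      (forall x, exists z : int, `|g.1 x| = z%:~R),
      (forall x y, adj x y -> exists z : int, `|g.2 x y| = z%:~R),
      finite_set [set x | g.1 x != 0]
    & finite_set [set p : V * V | g.2 p.1 p.2 != 0]].

Definition rate_node (g : state) (x : V) : R := `|g.1 x| / m x.
Definition jump_node (g : state) (x : V) : state :=
  (g.1, fun a b =>
     if adj a b && ((a == x) || (b == x))
     then g.2 a b + Num.sg (g.1 x) *: evec (if a == x then b else a) x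
     else g.2 a b).

(* (ii) edge <x,y> fires at rate k_xy |f(<x,y>)|; each unordered edge is
   indexed once, by its orientation with pickle x < pickle y. *)
Definition edge_idx : set (V * V) :=
  [set p | adj p.1 p.2 && (pickle p.1 < pickle p.2)%N].
Definition rate_edge (g : state) (p : V * V) : R := k p.1 p.2 * `|g.2 p.1 p.2|.
Definition jump_edge (g : state) (p : V * V) : state :=
  let s := Num.sg (dot (g.2 p.1 p.2) (evec p.1 p.2)) in
  (fun a => g.1 a + (if (a == p.1) && V0 a then s else 0)
                  - (if (a == p.2) && V0 a then s else 0), g.2).

Definition qrate (g g' : state) : \bar R :=
  (\esum_(x in [set: V]) (if `[< jump_node g x = g' >] then rate_node g x else 0)%:E
   + \esum_(p in edge_idx) (if `[< jump_edge g p = g' >] then rate_edge g p else 0)%:E)%E.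

(* total rate of leaving g: q(g) = sum_{g' <> g} q(g,g') *)
Definition qout (g : state) : \bar R :=
  (\esum_(x in [set: V]) (if `[< jump_node g x = g >] then 0 else rate_node g x)%:E
   + \esum_(p in edge_idx) (if `[< jump_edge g p = g >] then 0 else rate_edge g p)%:E)%E.

Definition jumpP (g g' : state) : R :=
  if `[< g' = g >] then (if fine (qout g) == 0 then 1 else 0)
  else (if fine (qout g) == 0 then 0 else fine (qrate g g') / fine (qout g)).

Definition jtime (Omega : Type) (S : nat -> Omega -> \bar R) (n : nat) (w : Omega)
  : \bar R := (\sum_(1 <= i < n.+1) S i w)%E.

(* (X_t)_{t>=0} is the continuous-time Markov jump process with the above
   Q-matrix started at f (Norris' jump chain / holding time definition):
   the jump chain (Y_n) and holding times (S_n)_{n>=1} have the joint law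
   P(Y_0=g_0,..,Y_n=g_n, S_1>s_1,..,S_n>s_n)
     = 1_{g_0=f} prod_{k=1}^n Pi(g_{k-1},g_k) exp(-q(g_{k-1}) s_k),
   and X_t = Y_n for J_n <= t < J_{n+1}.  The state components of X_t are
   random variables. *)
Definition is_IPS (d : measure_display) (Omega : measurableType d)
    (P : probability Omega R) (f : state)
    (Y : nat -> Omega -> state) (S : nat -> Omega -> \bar R)
    (X : R -> Omega -> state) : Prop :=
  (forall n g, measurable [set w | Y n w = g]) /\
      (forall n (s : R), measurable [set w | (s%:E < S n w)%E]) /\
      (forall n (gs : nat -> state) (ss : nat -> R),
          (forall i, 0 <= ss i) ->
          P ([set w | forall i, (i <= n)%N -> Y i w = gs i] `&`
             [set w | forall i, (1 <= i <= n)%N -> ((ss i)%:E < S i w)%E])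
          = ((if `[< gs 0%N = f >] then 1 else 0) *
             \prod_(1 <= i < n.+1)
                (jumpP (gs i.-1) (gs i) * expR (- fine (qout (gs i.-1)) * ss i)))%:E) /\
      (forall w t n, 0 <= t -> (jtime S n w <= t%:E)%E -> (t%:E < jtime S n.+1 w)%E ->
          X t w = Y n w) /\
      (forall t x, measurable_fun setT (fun w => (X t w).1 x)) /\
      (forall t x y, measurable_fun setT (fun w => dot ((X t w).2 x y) (evec x y))).

Definition meanN (d : measure_display) (Omega : measurableType d)
    (P : probability Omega R) (X : R -> Omega -> state) (x : V) (t : R) : R :=
  fine (\int[P]_w ((X t w).1 x)%:E)%E.

Definition meanE (d : measure_display) (Omega : measurableType d)
    (P : probability Omega R) (X : R -> Omega -> state) (x y : V) (t : R) : R :=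
  fine (\int[P]_w (dot ((X t w).2 x y) (evec x y))%:E)%E.

End IPS.

(* Main.v *)
Require Import Defs.
From HB Require Import structures.
From mathcomp Require Import all_boot all_order all_algebra finmap.
From mathcomp Require Import all_classical all_reals all_analysis.
From mathcomp Require Import measurable_realfun ring lra.
Import Order.TTheory GRing.Theory Num.Theory.
Import numFieldNormedType.Exports.
Set Implicit Arguments. Unset Strict Implicit. Unset Printing Implicit Defensive.
Local Open Scope classical_set_scope.
Local Open Scope ring_scope.

(** From a finitely supported state only finitely many transitions have positive
    rate, so the process follows one of finitely many paths during its first [n]
    jumps. Given the path, the holding times are independent exponentials, and
    memorylessness shows that the probability [A_p(t)] of sitting at the end of
    the path [p] at time [t] satisfies the forward equation
    [A_p' = - q A_p + (arrival rate along p)]. Summing over the paths with at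
    most [N] jumps gives the Kolmogorov equation for [E phi(X_t)] truncated at
    [N] jumps, up to a boundary term at level [N].

    The total mass [sum_x |f(x)| + sum_e |f(e)|] grows by a bounded amount at each
    jump and bounds the total jump rate, so after [n] jumps the rate and all
    coordinates are [O(n)]. Hence the third moment of the number of jumps before
    [t] is at most [exp (7 K t)] (Gronwall), which makes the boundary term and
    the tails [O(1/N)] locally uniformly in [t]: there is no explosion, and the
    Kolmogorov equation holds in the limit. On the coordinates the generator is
    the operator [L_G]. *)

(** * Calculus on the half-line *)

(** The obstacle is that the rates are unbounded. For a coordinate, both the rate and the value grow
    linearly with the number of jumps, so the boundary term at level [N] has a quadratic integrand;
    the third moment is the first integer moment that turns this into [O(1/N)].

    Densities and integrals over time are avoided. Holding times are known only through their tails,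
    so laws are compared on increments over short intervals: a defect bounded by the length of the
    interval times the increment of a monotone function disappears under subdivision. The same
    device yields the mean value inequality and Gronwall's lemma.

    Differentiability of a mean also requires control of the candidate derivative. The generator is
    therefore applied twice: its second image makes the mean of the first one Lipschitz in time, and
    this gives a second order expansion of the mean itself. This works because the generator maps
    coordinates to finite linear combinations of coordinates, which grow linearly again. *)

Section RealAnalysis.
Variable R : realType.
Implicit Types (u v w F : R -> R) (a b c t h C K : R).

Lemma le0_of_le_divn c C : (forall n : nat, c <= C / n.+1%:R) -> c <= 0.
Proof.
move=> h; rewrite leNgt; apply/negP => c0.
have C0 : 0 < C by have := h 0%N; rewrite divr1; exact: lt_le_trans.
have := h (Num.truncn (C / c)); rewrite ler_pdivlMr// mulrC -ler_pdivlMr// leNgt.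
by rewrite truncnS_gt.
Qed.

(** Cut the interval into [n.+1] equal pieces: the defects add up to at most
    [K * (b - a) * (F b - F a) / n.+1], for every [n]. With [F] the identity this is a mean value
    inequality; with [F] a distribution function it compares Stieltjes integrals, atoms included. *)
Lemma increment_le F w a b K : a <= b ->
  (forall x y, a <= x -> x <= y -> y <= b -> F x <= F y) ->
  (forall x y, a <= x -> x <= y -> y <= b ->
     w y - w x <= K * (y - x) * (F y - F x)) ->
  w b <= w a.
Proof.
move=> ab Fm hw; rewrite -subr_le0.
apply: (@le0_of_le_divn _ (K * (b - a) * (F b - F a))) => n.
pose h := (b - a) / n.+1%:R.
have h0 : 0 <= h by rewrite divr_ge0// subr_ge0.
have hn : h * n.+1%:R = b - a by rewrite divfK// pnatr_eq0.
have step : forall i : nat, (i <= n.+1)%N ->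
    w (a + h * i%:R) - w a <= K * h * (F (a + h * i%:R) - F a).
  elim=> [_|i IH lein]; first by rewrite mulr0 addr0 !subrr mulr0.
  have le1 : a <= a + h * i%:R by rewrite lerDl mulr_ge0.
  have le2 : a + h * i%:R <= a + h * i.+1%:R.
    by rewrite lerD2l ler_wpM2l// ler_nat.
  have le3 : a + h * i.+1%:R <= b.
    by rewrite -lerBrDl -hn ler_wpM2l// ler_nat.
  have := lerD (hw _ _ le1 le2 le3) (IH (ltnW lein)).
  have -> : a + h * i.+1%:R - (a + h * i%:R) = h by rewrite -natr1; ring.
  by lra.
have := step n.+1 (leqnn _); rewrite hn addrCA subrr addr0.
suff -> : K * (b - a) * (F b - F a) / n.+1%:R = K * h * (F b - F a) by [].
by rewrite /h; generalize (n.+1%:R^-1 : R) => e; ring.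
Qed.

Lemma expRN_ge1B t : 1 - t <= expR (- t).
Proof. exact: expR_ge1Dx. Qed.

Lemma expRN_quad t : 0 <= t -> `|expR (- t) - 1 + t| <= t ^+ 2.
Proof.
move=> t0; have h1 := expRN_ge1B t.
rewrite ger0_norm; last by lra.
have h2 : expR (- t) * (1 + t) <= 1.
  apply: (@le_trans _ _ (expR (- t) * expR t)).
    by rewrite ler_wpM2l ?expR_ge0// expR_ge1Dx.
  by rewrite -expRD addNr expR0.
rewrite -(@ler_pM2r _ (1 + t)); last by lra.
have : expR (- t) * (1 + t) + (t - 1) * (1 + t) <= t ^+ 2 * (1 + t) by nra.
by rewrite mulrDl; nra.
Qed.

(* [u] has derivative [v] on the half-line, with [u], [v] Lipschitz; the
   one-sided increments make the behaviour at [0] unexceptional *)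
Definition C11 u v := exists C, forall t h, 0 <= t -> 0 <= h ->
  [/\ `|u (t + h) - u t - h * v t| <= C * h ^+ 2,
      `|u (t + h) - u t| <= C * h & `|v (t + h) - v t| <= C * h].

Lemma C11_cst c u : (forall t, 0 <= t -> u t = c) -> C11 u (fun=> 0).
Proof.
move=> uc; exists 0 => t h t0 h0; rewrite !uc ?addr_ge0//.
by split; rewrite ?subrr ?mulr0 ?subrr ?normr0 ?mul0r.
Qed.

Lemma C11D u1 v1 u2 v2 : C11 u1 v1 -> C11 u2 v2 ->
  C11 (fun t => u1 t + u2 t) (fun t => v1 t + v2 t).
Proof.
move=> [C1 h1] [C2 h2]; exists (C1 + C2) => t h t0 h0.
have [a1 b1 c1] := h1 _ _ t0 h0; have [a2 b2 c2] := h2 _ _ t0 h0.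
rewrite !mulrDl; split.
- apply: le_trans (lerD a1 a2); apply: le_trans (ler_normD _ _).
  by rewrite le_eqVlt; apply/orP; left; apply/eqP; congr (`|_|); ring.
- apply: le_trans (lerD b1 b2); apply: le_trans (ler_normD _ _).
  by rewrite le_eqVlt; apply/orP; left; apply/eqP; congr (`|_|); ring.
- apply: le_trans (lerD c1 c2); apply: le_trans (ler_normD _ _).
  by rewrite le_eqVlt; apply/orP; left; apply/eqP; congr (`|_|); ring.
Qed.

Lemma C11Z c u v : C11 u v -> C11 (fun t => c * u t) (fun t => c * v t).
Proof.
move=> [C hC]; exists (`|c| * C) => t h t0 h0; have [a1 b1 c1] := hC _ _ t0 h0.
rewrite -!mulrA; split.
- have -> : c * u (t + h) - c * u t - h * (c * v t) = c * (u (t + h) - u t - h * v t) by ring.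
  by rewrite normrM ler_wpM2l.
- by rewrite -mulrBr normrM ler_wpM2l.
- by rewrite -mulrBr normrM ler_wpM2l.
Qed.

Lemma C11_ext u v u' v' : C11 u v ->
  (forall t, 0 <= t -> u t = u' t) -> (forall t, 0 <= t -> v t = v' t) -> C11 u' v'.
Proof.
move=> [C hC] hu hv; exists C => t h t0 h0.
by rewrite -!hu -?hv ?addr_ge0//; exact: hC.
Qed.

Lemma C11_sum (I : eqType) (r : seq I) (u v : I -> R -> R) :
  (forall i, i \in r -> C11 (u i) (v i)) ->
  C11 (fun t => \sum_(i <- r) u i t) (fun t => \sum_(i <- r) v i t).
Proof.
elim: r => [|i r IH] h.
  apply: (@C11_ext (fun=> 0) (fun=> 0)); first exact: (@C11_cst 0).
    by move=> t _; rewrite big_nil.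
  by move=> t _; rewrite big_nil.
have hi := h i (mem_head _ _).
apply: (C11_ext (C11D hi (IH _))) => [j jr|t _|t _]; rewrite ?big_cons//.
by apply: h; rewrite inE jr orbT.
Qed.

(** Over a short interval [u t - c * t] increases by at most a quadratic amount, so [increment_le]
    applies with [F] the identity. *)
Lemma C11_le u v c a b : C11 u v -> 0 <= a -> a <= b ->
  (forall t, a <= t -> t <= b -> v t <= c) -> u b - u a <= c * (b - a).
Proof.
move=> [C hC] a0 ab vc.
suff : u b - c * b <= u a - c * a by lra.
apply: (@increment_le id (fun t => u t - c * t) a b C) => // x y ax xy yb.
have [] := hC x (y - x) (le_trans a0 ax); first by rewrite subr_ge0.
rewrite [x + _]addrC subrK => /(le_trans (ler_norm _)) h1 _ _.
have h2 : (y - x) * v x <= (y - x) * c.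
  by rewrite ler_wpM2l ?subr_ge0// vc// (le_trans xy).
by nra.
Qed.

Lemma C11_norm_le u v c e a b : C11 u v -> 0 <= a -> a <= b ->
  (forall t, a <= t -> t <= b -> `|v t - c| <= e) ->
  `|u b - u a - c * (b - a)| <= e * (b - a).
Proof.
move=> uv a0 ab vc; rewrite ler_norml.
have h1 : u b - u a <= (c + e) * (b - a).
  apply: (C11_le uv) => // t at_ tb.
  by have := vc _ at_ tb; rewrite ler_norml => /andP[_]; lra.
have h2 : - 1 * u b - - 1 * u a <= (e - c) * (b - a).
  apply: (C11_le (C11Z (-1) uv)) => // t at_ tb.
  by have := vc _ at_ tb; rewrite ler_norml => /andP[+ _]; lra.
by apply/andP; split; lra.
Qed.

Lemma C11_gronwall u v c : C11 u v -> 0 <= c ->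
  (forall t, 0 <= t -> 0 <= u t) -> (forall t, 0 <= t -> v t <= c * u t) ->
  forall t, 0 <= t -> u t <= expR (c * t) * u 0.
Proof.
move=> [C hC] c0 u0 vu t t0.
have C0 : 0 <= C.
  by have [_ + _] := hC 0 1 (lexx _) ler01; rewrite mulr1; exact: le_trans.
suff : expR (- (c * t)) * u t <= expR (- (c * 0)) * u 0.
  rewrite mulr0 oppr0 expR0 mul1r => /(ler_wpM2l (expR_ge0 (c * t))).
  by rewrite mulrA -expRD subrr expR0 mul1r.
apply: (@increment_le id (fun t => expR (- (c * t)) * u t) 0 t C) => // x y x0 xy yt.
have yx0 : 0 <= y - x by rewrite subr_ge0.
have [] := hC x (y - x) x0 yx0; rewrite [x + _]addrC subrK => /(le_trans (ler_norm _)) h1 _ _.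
(* With the integrating factor at [x] expressed through the one at [y], only [1 + z <= expR z] is
   needed. *)
have -> : expR (- (c * x)) = expR (- (c * y)) * expR (c * (y - x)).
  by rewrite -expRD; congr expR; ring.
rewrite -mulrA -mulrBr.
have e1 : expR (- (c * y)) <= 1.
  by rewrite -expR0 ler_expR oppr_le0 mulr_ge0// (le_trans x0).
have h2 : (y - x) * v x <= (y - x) * (c * u x) by rewrite ler_wpM2l// vu.
have h3 : (1 + c * (y - x)) * u x <= expR (c * (y - x)) * u x.
  by rewrite ler_wpM2r ?u0// expR_ge1Dx.
have h4 : u y - expR (c * (y - x)) * u x <= C * (y - x) ^+ 2 by nra.
rewrite -mulrA -expr2; apply: (le_trans (ler_wpM2l (expR_ge0 _) h4)).
by rewrite ler_piMl// mulr_ge0// exprn_ge0.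
Qed.

Lemma increments_right_derivative u l B tau : 0 < tau ->
  (forall h, 0 <= h -> h <= tau -> `|u h - u 0 - l * h| <= B * h ^+ 2) ->
  h^-1 * (u h - u 0) @[h --> 0^'+] --> l.
Proof.
move=> tau0 hu.
have B0 : 0 <= B.
  have := hu tau (ltW tau0) (lexx _); rewrite -(pmulr_lge0 B (exprn_gt0 2 tau0)).
  exact: le_trans.
apply/cvgrPdist_le => e e0; near=> h.
have h0 : 0 < h by near: h; exact: nbhs_right_gt.
have htau : h <= tau by near: h; exact: nbhs_right_le.
have hB : h <= e / (B + 1) by near: h; apply: nbhs_right_le; rewrite divr_gt0// ltr_wpDl.
have := hu h (ltW h0) htau.
rewrite (_ : l - _ = - (h^-1 * (u h - u 0 - l * h))); last first.
  by field; rewrite gt_eqF.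
rewrite normrN normrM gtr0_norm ?invr_gt0// => hh.
rewrite ler_pdivrMl//; apply: (le_trans hh).
rewrite expr2 mulrA mulrC ler_pM2l//.
have := hB; rewrite ler_pdivlMr ?ltr_wpDl// mulrDr mulr1 [B * h]mulrC.
by apply: le_trans; rewrite lerDl ltW.
Unshelve. all: by end_near. Qed.

Lemma increments_is_derive u v B tau t : 0 < t -> t < tau ->
  (forall s r, 0 <= s -> s <= r -> r <= tau ->
     `|u r - u s - v s * (r - s)| <= B * (r - s) ^+ 2 /\ `|v r - v s| <= B * (r - s)) ->
  is_derive t 1 u (v t).
Proof.
move=> t0 ttau hu.
have B0 : 0 <= B.
  have [_] := hu 0 tau (lexx _) (ltW (lt_trans t0 ttau)) (lexx _).
  move=> /(le_trans (normr_ge0 _)); rewrite subr0 pmulr_lge0//; exact: lt_trans ttau.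
have key h : h != 0 -> `|h| <= t -> `|h| <= tau - t ->
    `|v t - h^-1 * (u (h + t) - u t)| <= 2 * B * `|h|.
  have [h0 _ _ ht|h0 _ ht _|<-] := ltgtP 0 h; last by [].
  - have htau : h + t <= tau by move: ht; rewrite ger0_norm ?(ltW h0)//; lra.
    have tht : t <= h + t by lra.
    have [+ _] := hu t (h + t) (ltW t0) tht htau.
    rewrite (_ : h + t - t = h); last by ring.
    move=> hh.
    rewrite (_ : v t - _ = - (h^-1 * (u (h + t) - u t - v t * h))); last first.
      by field; rewrite gt_eqF.
    rewrite normrN normrM (gtr0_norm h0) gtr0_norm ?invr_gt0// ler_pdivrMl//.
    apply: (le_trans hh); rewrite (_ : h * _ = B * h ^+ 2 + B * h ^+ 2); last by ring.
    by rewrite lerDl mulr_ge0// exprn_ge0// ltW.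
  - have h0' : 0 <= h + t by move: ht; rewrite ltr0_norm//; lra.
    have tht : h + t <= t by lra.
    have [] := hu (h + t) t h0' tht (ltW ttau).
    rewrite (_ : t - (h + t) = - h); last by ring.
    move=> h1 h2.
    (* For [h < 0] the expansion starts at [h + t], with slope [v (h + t)]; the Lipschitz bound
       moves the slope to [v t] and costs the second [B]. *)
    rewrite (_ : v t - _ = (v t - v (h + t)) +
      h^-1 * (u t - u (h + t) - v (h + t) * - h)); last first.
      by field; rewrite lt_eqF.
    rewrite (ltr0_norm h0); apply: (le_trans (ler_normD _ _)).
    rewrite -mulrA [leRHS](_ : _ = B * - h + B * - h); last by ring.
    apply: lerD => //.
    rewrite normrM normfV (ltr0_norm h0) ler_pdivrMl ?oppr_gt0//.
    by apply: (le_trans h1); rewrite le_eqVlt; apply/orP; left; apply/eqP; ring.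
have H : h^-1 *: ((u \o shift t) (h *: 1) - u t) @[h --> 0^'] --> v t.
  have sm c : 0 < c -> \forall x \near (0 : R)^', `|x| <= c.
    by move=> c0; apply: dnbhs0_le.
  apply/cvgrPdist_le => e e0; near=> h.
  have h0 : h != 0 by near: h; exact: nbhs_dnbhs_neq.
  have h1 : `|h| <= t by near: h; exact: sm.
  have h2 : `|h| <= tau - t by near: h; apply: sm; rewrite subr_gt0.
  have h3 : `|h| <= e / (2 * B + 1).
    by near: h; apply: sm; rewrite divr_gt0// ltr_wpDl// mulr_ge0.
  have := key h h0 h1 h2; rewrite /= /GRing.scale/= mulr1 => /le_trans; apply.
  move: h3; rewrite ler_pdivlMr; last by rewrite ltr_wpDl// mulr_ge0.
  by move: (normr_ge0 h); lra.
by apply: DeriveDef; [exact: cvgP H|exact: cvg_lim H].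
Unshelve. all: by end_near. Qed.

End RealAnalysis.

(** * Jump processes *)

Lemma emeasurable_fun_gt d (Omega : measurableType d) (R : realType)
    (X : Omega -> \bar R) :
  (forall s : R, measurable [set w | (s%:E < X w)%E]) -> measurable_fun setT X.
Proof.
move=> mX; apply: (measurability _ (ErealGenOInfty.measurableE R)) => //.
move=> _ [_ [s ->] <-]; rewrite setTI.
by rewrite (_ : _ @^-1` _ = [set w | (s%:E < X w)%E])//; apply/seteqP; split => w /=;
  rewrite in_itv/= andbT.
Qed.

(** * Real-valued probabilities, and an exponential clock started at a random time *)

Section RealProbability.
Context d (Omega : measurableType d) (R : realType) (P : probability Omega R).
Implicit Types A B : set Omega.

Definition pr A : R := fine (P A).

Lemma prE A : measurable A -> P A = (pr A)%:E.
Proof. by move=> mA; rewrite /pr fineK// fin_num_measure. Qed.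

Lemma pr_ge0 A : 0 <= pr A.
Proof. exact: fine_ge0. Qed.

Lemma pr_le A B : measurable A -> measurable B -> A `<=` B -> pr A <= pr B.
Proof.
by move=> mA mB AB; rewrite -lee_fin -!prE// le_measure// inE.
Qed.

Lemma pr_le1 A : measurable A -> pr A <= 1.
Proof. by move=> mA; rewrite -lee_fin -prE// probability_le1. Qed.

Lemma pr_split A B : measurable A -> measurable B ->
  pr A = pr (A `&` B) + pr (A `\` B).
Proof.
move=> mA mB; apply: EFin_inj; rewrite EFinD -!prE//; last 2 first.
- exact: measurableD.
- exact: measurableI.
by rewrite addeC [LHS](measureDI P mA mB).
Qed.

Lemma pr_bigsetU (I : choiceType) (r : seq I) (F : I -> set Omega) :
  uniq r -> (forall i, measurable (F i)) ->
  (forall i j w, i \in r -> j \in r -> F i w -> F j w -> i = j) ->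
  pr (\big[setU/set0]_(i <- r) F i) = \sum_(i <- r) pr (F i).
Proof.
elim: r => [_ _ _|i r IH /andP[ir ur] mF tF].
  by rewrite !big_nil /pr measure0.
have mU : measurable (\big[setU/set0]_(j <- r) F j) by apply: bigsetU_measurable.
rewrite !big_cons (@pr_split _ (F i))//; last exact: measurableU.
rewrite setUK; congr (_ + _).
rewrite -IH// => [|j k w jr kr]; last by apply: tF; rewrite inE ?jr ?kr orbT.
congr pr; apply/seteqP; split => [w [[]//]|w Uw]; split; first by right.
move: Uw; rewrite -bigcup_seq => -[j /= jr Fjw] Fiw.
have ij : i = j by apply: (tF i j w) => //; rewrite !inE ?eqxx// jr orbT.
by move: ir; rewrite ij jr.
Qed.

Lemma measurable_ele (X : Omega -> \bar R) (u : \bar R) :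
  measurable_fun setT X -> measurable [set w | (X w <= u)%E].
Proof.
by move=> mX; rewrite -[X in measurable X]setTI; exact: emeasurable_fun_infty_c.
Qed.

Lemma measurable_elt (X : Omega -> \bar R) (u : \bar R) :
  measurable_fun setT X -> measurable [set w | (u < X w)%E].
Proof.
by move=> mX; rewrite -[X in measurable X]setTI; exact: emeasurable_fun_o_infty.
Qed.

Section TwoClocks.
Variables (U Z : Omega -> \bar R) (q : R) (F : R -> R).
Hypotheses (mU : measurable_fun setT U) (mZ : measurable_fun setT Z).
Hypothesis U_ge0 : forall w, (0 <= U w)%E.

(** On the slab [x < U <= y], the event [r < U + Z] contains [r - x < Z] and is contained in
    [r - y < Z]; the product form gives the probability of both. *)
Lemma two_clocks_increment E (c r x y : R) : measurable E ->
  (forall u s, 0 <= s -> pr (E `&` [set w | (U w <= u%:E)%E] `&`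
     [set w | (s%:E < Z w)%E]) = c * F u * expR (- q * s)) ->
  x <= y -> y <= r ->
  c * expR (- q * (r - x)) * (F y - F x) <=
    pr (E `&` [set w | (U w <= y%:E)%E] `&` [set w | (r%:E < U w + Z w)%E]) -
    pr (E `&` [set w | (U w <= x%:E)%E] `&` [set w | (r%:E < U w + Z w)%E])
  <= c * expR (- q * (r - y)) * (F y - F x).
Proof.
move=> mE hE xy yr.
have mUu u : measurable [set w | (U w <= u%:E)%E] by exact: measurable_ele.
have mZs s : measurable [set w | (s%:E < Z w)%E] by exact: measurable_elt.
have mUZ : measurable [set w | (r%:E < U w + Z w)%E].
  by apply: measurable_elt; exact: emeasurable_funD.
have sub B : measurable B ->
    pr (E `&` [set w | (U w <= y%:E)%E] `&` B) - pr (E `&` [set w | (U w <= x%:E)%E] `&` B)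
    = pr ((E `&` [set w | (U w <= y%:E)%E] `&` B) `\` [set w | (U w <= x%:E)%E]).
  move=> mB; rewrite (@pr_split (E `&` _ `&` B) [set w | (U w <= x%:E)%E])//; last first.
    by apply: measurableI => //; exact: measurableI.
  rewrite (_ : _ `&` _ `&` _ `&` _ = E `&` [set w | (U w <= x%:E)%E] `&` B).
    by rewrite addrAC subrr add0r.
  apply/seteqP; split => w /= => [[[[? ?] ?] ?]//|[[? Ux] ?]].
  by do !split => //; apply: le_trans Ux _; rewrite lee_fin.
have mD B : measurable B ->
    measurable ((E `&` [set w | (U w <= y%:E)%E] `&` B) `\` [set w | (U w <= x%:E)%E]).
  by move=> mB; apply: measurableD => //; apply: measurableI => //; exact: measurableI.
have piece s : 0 <= s -> c * expR (- q * s) * (F y - F x) =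
    pr ((E `&` [set w | (U w <= y%:E)%E] `&` [set w | (s%:E < Z w)%E])
       `\` [set w | (U w <= x%:E)%E]).
  by move=> s0; rewrite -sub// !hE//; ring.
rewrite sub// !piece ?subr_ge0//; last exact: le_trans yr.
apply/andP; split; (apply: pr_le; [exact: mD|exact: mD|]) => w /=.
- move=> [[[Ew Uy] Zr] /negP]; rewrite -ltNge => Ux; split; last by apply/negP; rewrite -ltNge.
  split => //; move: Uy Zr Ux (U_ge0 w); case: (U w) (Z w) => [a| |] [b| |]//=;
    rewrite -?EFinD ?lte_fin ?lee_fin ?ltry//; lra.
- move=> [[[Ew Uy] Zr] Ux]; split => //; split => //.
  move: Uy Zr (U_ge0 w); case: (U w) (Z w) => [a| |] [b| |]//=;
    rewrite -?EFinD ?lte_fin ?lee_fin ?ltry//; lra.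
Qed.

(* memorylessness: both sides are Stieltjes integrals of [expR (- q * (t - u))]
   against [F], up to the factor [c * expR (- q * h)] *)
Lemma two_clocks_memoryless E1 E2 (c t h : R) : measurable E1 -> measurable E2 ->
  0 <= q -> 0 <= c -> 0 <= t -> 0 <= h ->
  (forall u u', u <= u' -> F u <= F u') ->
  (forall u s, 0 <= s -> pr (E1 `&` [set w | (U w <= u%:E)%E] `&`
     [set w | (s%:E < Z w)%E]) = c * F u * expR (- q * s)) ->
  (forall u s, 0 <= s -> pr (E2 `&` [set w | (U w <= u%:E)%E] `&`
     [set w | (s%:E < Z w)%E]) = F u * expR (- q * s)) ->
  pr (E1 `&` [set w | (U w <= t%:E)%E] `&` [set w | ((t + h)%:E < U w + Z w)%E]) =
  c * expR (- q * h) *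
  pr (E2 `&` [set w | (U w <= t%:E)%E] `&` [set w | (t%:E < U w + Z w)%E]).
Proof.
move=> mE1 mE2 q0 c0 t0 h0 Fm h1 h2.
have {}h2 u s : 0 <= s -> pr (E2 `&` [set w | (U w <= u%:E)%E] `&`
    [set w | (s%:E < Z w)%E]) = 1 * F u * expR (- q * s) by rewrite mul1r; exact: h2.
pose G1 x := pr (E1 `&` [set w | (U w <= x%:E)%E] `&` [set w | ((t + h)%:E < U w + Z w)%E]).
pose G2 x := pr (E2 `&` [set w | (U w <= x%:E)%E] `&` [set w | (t%:E < U w + Z w)%E]).
(* Both sides vanish at [-1] because [U] is nonnegative. The comparison starts there and not at [0],
   since [F] may have an atom at [0], as it does before the first jump. *)
have G0 E r : pr (E `&` [set w | (U w <= (-1)%:E)%E] `&` [set w | (r%:E < U w + Z w)%E]) = 0.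
  rewrite (_ : _ `&` _ `&` _ = set0) ?/pr ?measure0//.
  apply/seteqP; split => w //= [[_ Um1] _].
  by have := le_trans (U_ge0 w) Um1; rewrite lee_fin lerNr oppr0 ler10.
(* The upper and lower bounds on a slab differ by [expR (- q * (t - y)) - expR (- q * (t - x)) <= q
   * (y - x)], which makes the defect a length times an increment of [F]. *)
have key x y : -1 <= x -> x <= y -> y <= t ->
    `|(G1 y - G1 x) - c * expR (- q * h) * (G2 y - G2 x)| <= c * q * (y - x) * (F y - F x).
  move=> x1 xy yt.
  have yth : y <= t + h by rewrite (le_trans yt)// lerDl.
  have := two_clocks_increment mE1 h1 xy yth.
  have := two_clocks_increment mE2 h2 xy yt.
  rewrite -!/(G1 _) -!/(G2 _) !mul1r.
  have expE z : expR (- q * (t + h - z)) = expR (- q * h) * expR (- q * (t - z)).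
    by rewrite -expRD; congr expR; ring.
  have AB : expR (- q * (t - x)) = expR (- q * (t - y)) * expR (- (q * (y - x))).
    by rewrite -expRD; congr expR; ring.
  rewrite !expE; set e := expR (- q * h); set A := expR (- q * (t - x)) in AB *.
  set B := expR (- q * (t - y)) in AB *; set dF := F y - F x => /andP[a2 b2] /andP[a1 b1].
  have dF0 : 0 <= dF by rewrite subr_ge0 Fm.
  have e0 : 0 <= e by exact: expR_ge0.
  have e1 : e <= 1 by rewrite -expR0 ler_expR mulNr oppr_le0 mulr_ge0.
  have B0 : 0 <= B by exact: expR_ge0.
  have B1 : B <= 1 by rewrite -expR0 ler_expR mulNr oppr_le0 mulr_ge0// subr_ge0.
  have qz0 : 0 <= q * (y - x) by rewrite mulr_ge0// subr_ge0.
  have BA : B - A <= q * (y - x).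
    have -> : B - A = B * (1 - expR (- (q * (y - x)))) by rewrite AB; ring.
    apply: (@le_trans _ _ (B * (q * (y - x)))); last by rewrite ler_piMl.
    by rewrite ler_wpM2l// lerBlDr -lerBlDl expRN_ge1B.
  have ce0 : 0 <= c * e by rewrite mulr_ge0.
  have a2' := ler_wpM2l ce0 a2; have b2' := ler_wpM2l ce0 b2.
  have eBA : c * e * ((B - A) * dF) <= c * q * (y - x) * dF.
    apply: (@le_trans _ _ (c * e * (q * (y - x) * dF))).
      by rewrite ler_wpM2l// ler_wpM2r.
    rewrite [leRHS](_ : _ = c * (q * (y - x) * dF)); last by ring.
    by rewrite -mulrA ler_wpM2l// ler_piMl// mulr_ge0.
  by rewrite ler_norml; apply/andP; split; lra.
have D0 : G1 t - c * expR (- q * h) * G2 t = 0.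
  apply/eqP; rewrite eq_le; apply/andP; split.
  - have : G1 t - c * expR (- q * h) * G2 t <= G1 (-1) - c * expR (- q * h) * G2 (-1).
      apply: (@increment_le _ F (fun x => G1 x - c * expR (- q * h) * G2 x) (-1) t (c * q)).
      + by lra.
      + by move=> *; exact: Fm.
      + by move=> x y x1 xy yt; have := key x y x1 xy yt; rewrite ler_norml => /andP[_]; lra.
    by rewrite /G1 /G2 !G0 mulr0 subr0.
  - have : - (G1 t - c * expR (- q * h) * G2 t) <= - (G1 (-1) - c * expR (- q * h) * G2 (-1)).
      apply: (@increment_le _ F (fun x => - (G1 x - c * expR (- q * h) * G2 x)) (-1) t (c * q)).
      + by lra.
      + by move=> *; exact: Fm.
      + by move=> x y x1 xy yt; have := key x y x1 xy yt; rewrite ler_norml => /andP[+ _]; lra.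
    by rewrite /G1 /G2 !G0 mulr0 subr0 oppr0; lra.
by apply/eqP; rewrite -subr_eq0 D0.
Qed.
End TwoClocks.

End RealProbability.

(** * Laws of finite histories of the jump chain and the holding times *)

Section JumpProcess.
Context d (Omega : measurableType d) (R : realType) (P : probability Omega R).
Variables (T : choiceType) (f : T) (q : T -> R) (Pi : T -> T -> R).
Variables (Y : nat -> Omega -> T) (S : nat -> Omega -> \bar R).
Hypothesis mY : forall n g, measurable [set w | Y n w = g].
Hypothesis mS : forall n (s : R), measurable [set w | (s%:E < S n w)%E].
Hypothesis law : forall n (gs : nat -> T) (ss : nat -> R),
  (forall i, 0 <= ss i) ->
  P ([set w | forall i, (i <= n)%N -> Y i w = gs i] `&`
     [set w | forall i, (1 <= i <= n)%N -> ((ss i)%:E < S i w)%E])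
  = ((if `[< gs 0%N = f >] then 1 else 0) *
     \prod_(1 <= i < n.+1)
        (Pi (gs i.-1) (gs i) * expR (- q (gs i.-1) * ss i)))%:E.
Implicit Types (n : nat) (p : seq T) (g : T) (w : Omega) (t u s h : R).

(* histories and paths are listed backwards, the current state first *)
Fixpoint hist n w : seq T :=
  if n is n'.+1 then Y n w :: hist n' w else [:: Y 0%N w].

(** [S] may be negative on a null set; truncation makes [jumpt] nondecreasing in [n] at every sample
    point. *)
Definition hold n w : \bar R := maxe (S n w) 0%E.

Fixpoint jumpt n w : \bar R :=
  if n is n'.+1 then (jumpt n' w + hold n w)%E else 0%E.

(** Strict positivity is part of the event: there [hold] and [S] agree, and [law] with all
    thresholds equal to [0] gives the probability. *)
Definition path_ev n p : set Omega :=
  [set w | hist n w = p] `&`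
  [set w | forall i, (1 <= i <= n)%N -> (0 < S i w)%E].

Lemma hold_ge0 n w : (0 <= hold n w)%E.
Proof. by rewrite /hold le_max lexx orbT. Qed.

Lemma jumpt_ge0 n w : (0 <= jumpt n w)%E.
Proof. by elim: n => //= n IH; rewrite adde_ge0// hold_ge0. Qed.

Lemma histP n p w : size p = n.+1 ->
  (hist n w = p) <-> (forall i, (i <= n)%N -> Y i w = nth f p (n - i)).
Proof.
elim: n p => [|n IH] [|g p]//= [sp].
  case: p sp => // _; split=> [[<-] [|]//|/(_ 0%N) /= -> //].
split=> [[Yg /(IH _ sp) h] i|h].
  rewrite leq_eqVlt => /predU1P[->|]; first by rewrite subnn.
  by rewrite ltnS => lin; rewrite subSn//= h.
congr cons; first by rewrite h// subnn.
by apply/(IH _ sp) => i lin; rewrite h ?subSn// leqW.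
Qed.

(** Extending the history by one state adds exactly one last factor to the product in [law].
    Histories being listed backwards, state [i] is entry [n - i]. *)
Lemma law_hist n p g (ss : nat -> R) : size p = n.+1 -> (forall i, 0 <= ss i) ->
  pr P ([set w | hist n.+1 w = g :: p] `&`
     [set w | forall i, (1 <= i <= n.+1)%N -> ((ss i)%:E < S i w)%E])
  = Pi (head f p) g * expR (- q (head f p) * ss n.+1) *
    pr P ([set w | hist n w = p] `&`
     [set w | forall i, (1 <= i <= n)%N -> ((ss i)%:E < S i w)%E]).
Proof.
move=> sp ss0.
have histE m r : size r = m.+1 ->
    [set w | hist m w = r] = [set w | forall i, (i <= m)%N -> Y i w = nth f r (m - i)].
  by move=> sr; apply/seteqP; split => w /(histP _ sr).
rewrite (histE n.+1 (g :: p)) ?(histE n p)//=; last by rewrite sp.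
rewrite /pr !(law _ (fun i => nth f _ (_ - i)))//= big_nat_recr//=.
rewrite subSn// !subn0 -!nth0 /= subnn [RHS]mulrC mulrA; congr (_ * _ * _).
  apply: eq_big_nat => -[//|i] /andP[_ lin] /=.
  have -> : (n.+1 - i = (n - i).+1)%N by rewrite subSn// ltnW.
  by have -> : (n.+1 - i.+1 = (n - i.+1).+1)%N by rewrite subSS subnSK.
by rewrite subnn.
Qed.

Lemma measurable_hist n p : measurable [set w | hist n w = p].
Proof.
elim: n p => [|n IH] p /=.
  case: p => [|g [|g' p]].
  - by rewrite (_ : [set _ | _] = set0)//; apply/seteqP; split.
  - rewrite (_ : [set _ | _] = [set w | Y 0 w = g])//.
    by apply/seteqP; split => w /= [->].
  - by rewrite (_ : [set _ | _] = set0)//; apply/seteqP; split.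
case: p => [|g p].
  by rewrite (_ : [set _ | _] = set0)//; apply/seteqP; split.
rewrite (_ : [set _ | _] = [set w | Y n.+1 w = g] `&` [set w | hist n w = p]).
  exact: measurableI.
by apply/seteqP; split => w /= [-> ->].
Qed.

Lemma measurable_forall_le n (A : nat -> set Omega) :
  (forall i, measurable (A i)) ->
  measurable [set w | forall i, (1 <= i <= n)%N -> A i w].
Proof.
move=> mA.
rewrite (_ : [set _ | _] = \bigcap_(i in [set i | (1 <= i <= n)%N]) A i)//.
by apply: bigcap_measurableType => i _.
Qed.

Lemma measurable_path_ev n p : measurable (path_ev n p).
Proof.
apply: measurableI; first exact: measurable_hist.
by apply: (@measurable_forall_le n (fun i => [set w | (0%:E < S i w)%E])).
Qed.

Lemma measurable_hold n : measurable_fun setT (hold n).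
Proof.
by apply: measurable_maxe => //; apply: emeasurable_fun_gt => s; exact: mS.
Qed.

Lemma measurable_jumpt n : measurable_fun setT (jumpt n).
Proof.
elim: n => [|n IH]; first exact: measurable_cst.
by apply: emeasurable_funD => //; exact: measurable_hold.
Qed.

Definition hold_cyl n (ss : nat -> R) : set Omega :=
  [set w | forall i, (1 <= i <= n)%N -> ((ss i)%:E < hold i w)%E].

Lemma hold_gt0E i w : (0 < S i w)%E -> hold i w = S i w.
Proof. by move=> /ltW S0; rewrite /hold max_l. Qed.

(** [law] accepts nonnegative thresholds only; where the holding times are positive, a negative
    threshold can be raised to [0]. *)
Lemma path_ev_cyl n p ss : path_ev n p `&` hold_cyl n ss =
  [set w | hist n w = p] `&`
  [set w | forall i, (1 <= i <= n)%N -> ((Num.max (ss i) 0)%:E < S i w)%E].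
Proof.
apply/seteqP; split => w /=.
  move=> [[-> S0] sS]; split=> // i lin; rewrite EFin_max gt_max S0// andbT.
  by have := sS i lin; rewrite hold_gt0E// S0.
move=> [hp sS]; split; [split=> // i lin|move=> i lin];
  have := sS i lin; rewrite EFin_max gt_max => /andP[s1 s2]//.
by rewrite hold_gt0E.
Qed.

Lemma path_ev_cyl_law n p g ss s : size p = n.+1 -> 0 <= s ->
  pr P (path_ev n.+1 (g :: p) `&` [set w | (s%:E < hold n.+1 w)%E] `&` hold_cyl n ss) =
  Pi (head f p) g * expR (- q (head f p) * s) * pr P (path_ev n p `&` hold_cyl n ss).
Proof.
move=> sp s0; pose ss' i := if i == n.+1 then s else ss i.
have ss'E i : (i <= n)%N -> ss' i = ss i.
  by move=> lin; rewrite /ss'; case: eqP => // ei; move: lin; rewrite ei ltnn.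
have -> : path_ev n.+1 (g :: p) `&` [set w | (s%:E < hold n.+1 w)%E] `&` hold_cyl n ss
    = path_ev n.+1 (g :: p) `&` hold_cyl n.+1 ss'.
  rewrite -setIA; congr setI; apply/seteqP; split => w /=.
    move=> [sw ssw] i /andP[i0]; rewrite leq_eqVlt => /predU1P[->|].
      by rewrite /ss' eqxx.
    by rewrite ltnS => lin; rewrite ss'E// ssw// i0.
  move=> h; split; first by have := h n.+1; rewrite /ss' eqxx; apply; rewrite /= leqnn.
  by move=> i /andP[i0 lin]; rewrite -ss'E//; apply: h; rewrite i0 leqW.
rewrite !path_ev_cyl law_hist//; last by move=> i; rewrite le_max lexx orbT.
rewrite {1}/ss' eqxx max_l//; congr (_ * pr P (_ `&` _)).
by apply/seteqP; split => w /= h i lin; have := h i lin; rewrite ss'E//; case/andP: lin.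
Qed.

Definition cyls n : set (set Omega) := range (hold_cyl n).

Lemma cyls_setI n : setI_closed (cyls n).
Proof.
move=> _ _ [s1 _ <-] [s2 _ <-]; exists (fun i => Num.max (s1 i) (s2 i)) => //.
apply/seteqP; split => w /= h.
  by split=> i lin; have := h i lin; rewrite EFin_max gt_max => /andP[].
by move=> i lin; rewrite EFin_max gt_max h.1// h.2.
Qed.

Lemma measurable_cyl n ss : measurable (hold_cyl n ss).
Proof.
apply: (@measurable_forall_le n (fun i => [set w | ((ss i)%:E < hold i w)%E])) => i.
by rewrite -[X in measurable X]setTI; exact: emeasurable_fun_o_infty (measurable_hold i) _.
Qed.

Lemma cylsT n : cyls n setT.
Proof.
(* The threshold [-1] is no condition, since [hold] is nonnegative. *)
exists (fun=> -1) => //; apply/seteqP; split => // w _ i lin.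
by apply: lt_le_trans (hold_ge0 i w); rewrite lte_fin ltrN10.
Qed.

(** Pi-lambda argument: the cylinders are stable under intersection, and the events [B] satisfying
    the identity form a lambda system. In effect, given the path so far, the next state and holding
    time are independent of the earlier holding times. *)
Lemma path_ev_sigma_law n p g s (B : set Omega) : size p = n.+1 -> 0 <= s ->
  <<s cyls n >> B ->
  pr P (path_ev n.+1 (g :: p) `&` [set w | (s%:E < hold n.+1 w)%E] `&` B) =
  Pi (head f p) g * expR (- q (head f p) * s) * pr P (path_ev n p `&` B).
Proof.
move=> sp s0; set c := Pi _ _ * _.
set X := _ `&` [set w | _]; set Z := path_ev n p.
have mX : measurable X.
  apply: measurableI; first exact: measurable_path_ev.
  by rewrite -[X in measurable X]setTI; exact: emeasurable_fun_o_infty (measurable_hold _) _.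
have mZ : measurable Z by exact: measurable_path_ev.
pose H := [set B | measurable B /\ pr P (X `&` B) = c * pr P (Z `&` B)].
suff : <<s cyls n >> `<=` H by move=> h /h[].
have cylH : cyls n `<=` H.
  move=> _ [ss _ <-]; split; first exact: measurable_cyl.
  exact: path_ev_cyl_law.
apply: (@lambda_system_subset _ _ (@cyls_setI n) setT H _ cylH); last by [].
split => //.
- exact: cylH (cylsT n).
- move=> A B' BA [mA hA] [mB hB]; split; first exact: measurableD.
  have splitE W : measurable W -> pr P (W `&` (A `\` B')) = pr P (W `&` A) - pr P (W `&` B').
    move=> mW; rewrite (@pr_split _ _ _ P (W `&` A) B')//; last exact: measurableI.
    rewrite -setIA (_ : A `&` B' = B'); last by apply/setIidPr.
    by rewrite setIDA [RHS]addrAC subrr add0r.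
  by rewrite !splitE// hA hB; ring.
- move=> F ndF hF.
  have mF i : measurable (F i) by have [] := hF i.
  have mUF : measurable (\bigcup_i F i) by exact: bigcupT_measurable.
  split => //.
  have cvF W : measurable W ->
      pr P (W `&` F i) @[i --> \oo] --> pr P (W `&` \bigcup_i F i).
    move=> mW; apply: fine_cvg; rewrite -prE; last exact: measurableI.
    rewrite setI_bigcupr; apply: (@nondecreasing_cvg_mu _ _ _ P (fun i => W `&` F i)).
    + by move=> i; exact: measurableI.
    + by apply: bigcupT_measurable => i; exact: measurableI.
    + by move=> i j ij; apply/subsetPset; apply: setIS; apply/subsetPset; exact: ndF.
  have h1 := cvF _ mX.
  have h2 : c * pr P (Z `&` F i) @[i --> \oo] --> c * pr P (Z `&` \bigcup_i F i).
    by apply: cvgM; [exact: cvg_cst|exact: cvF].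
  have e : (fun i => pr P (X `&` F i)) = (fun i => c * pr P (Z `&` F i)).
    by apply/funext => i; have [] := hF i.
  by rewrite e in h1; exact: (norm_cvg_unique h1 h2).
Qed.

Lemma jumpt_sigma n u : <<s cyls n >> [set w | (jumpt n w <= u%:E)%E].
Proof.
have mh i : (1 <= i <= n)%N ->
    measurable_fun setT (hold i : g_sigma_algebraType (cyls n) -> \bar R).
  move=> lin; apply: emeasurable_fun_gt => s; apply: sub_sigma_algebra.
  exists (fun j => if j == i then s else -1) => //.
  apply/seteqP; split => w /= h; first by have := h i lin; rewrite eqxx.
  move=> j _; case: eqP => [->//|_].
  by apply: lt_le_trans (hold_ge0 j w); rewrite lte_fin ltrN10.
suff mj m : (m <= n)%N ->
    measurable_fun setT (jumpt m : g_sigma_algebraType (cyls n) -> \bar R).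
  rewrite -[X in <<s _ >> X]setTI.
  exact: (emeasurable_fun_infty_c _ (mj n (leqnn n)) u%:E).
elim: m => [_|m IH lemn]; first exact: measurable_cst.
apply: emeasurable_funD; first exact: IH (ltnW lemn).
by apply: mh.
Qed.

(** * The forward equation along a single path *)

Variable nxt : T -> seq T.

(** [nxt g] is a finite list meant to carry all the mass of [Pi g]. Total mass [1] and the rate
    bound are imposed along [paths] only, that is, at states that can be reached from [f]. *)
Fixpoint paths n : seq (seq T) :=
  if n is n'.+1 then [seq g :: p | p <- paths n', g <- nxt (head f p)]
  else [:: [:: f]].

Hypothesis q_ge0 : forall g, 0 <= q g.
Hypothesis Pi_ge0 : forall g g', 0 <= Pi g g'.
Hypothesis nxt_uniq : forall g, uniq (nxt g).
Hypothesis Pi_sum : forall n p, p \in paths n ->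
  \sum_(g <- nxt (head f p)) Pi (head f p) g = 1.

Lemma size_paths n p : p \in paths n -> size p = n.+1.
Proof.
elim: n p => [|n IH] p /=; first by rewrite inE => /eqP->.
by move=> /allpairsPdep[p' [g [/IH sp' _ ->]]] /=; rewrite sp'.
Qed.

Lemma uniq_paths n : uniq (paths n).
Proof.
elim: n => //= n IH; apply: allpairs_uniq_dep => //.
by move=> [a b] [a' b'] _ _ /= [-> ->].
Qed.

Definition arrived n p t : R :=
  pr P (path_ev n p `&` [set w | (jumpt n w <= t%:E)%E]).

Definition occupied n p t : R :=
  pr P (path_ev n p `&` [set w | (jumpt n w <= t%:E)%E] `&`
    [set w | (t%:E < jumpt n.+1 w)%E]).

Let mjle n u : measurable [set w | (jumpt n w <= u%:E)%E].
Proof. by apply: measurable_ele; exact: measurable_jumpt. Qed.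

Let mjlt n u : measurable [set w | (u%:E < jumpt n w)%E].
Proof. by apply: measurable_elt; exact: measurable_jumpt. Qed.

Let mhlt n u : measurable [set w | (u%:E < hold n w)%E].
Proof. by apply: measurable_elt; exact: measurable_hold. Qed.

Let mpath := measurable_path_ev.

(** This is the product form required by [two_clocks_memoryless], with [arrived n p] as the
    distribution function [F]. *)
Lemma path_ev_step_law n p g u s : size p = n.+1 -> 0 <= s ->
  pr P (path_ev n.+1 (g :: p) `&` [set w | (jumpt n w <= u%:E)%E] `&`
    [set w | (s%:E < hold n.+1 w)%E]) =
  Pi (head f p) g * arrived n p u * expR (- q (head f p) * s).
Proof.
move=> sp s0; rewrite setIAC path_ev_sigma_law//; last exact: jumpt_sigma.
by rewrite /arrived; ring.
Qed.

Lemma path_ev_step_arrived n p g u : size p = n.+1 ->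
  pr P (path_ev n.+1 (g :: p) `&` [set w | (jumpt n w <= u%:E)%E]) =
  Pi (head f p) g * arrived n p u.
Proof.
move=> sp; have := path_ev_step_law g u sp (lexx 0).
rewrite mulr0 expR0 mulr1 => <-; congr (pr P _); rewrite setIAC; congr setI.
apply/esym/setIidPl => w [_ /(_ n.+1)]; rewrite ltnS leqnn /= => /(_ isT) S0.
by rewrite hold_gt0E.
Qed.

Lemma path_ev_sub n p g : path_ev n.+1 (g :: p) `<=` path_ev n p.
Proof.
by move=> w [/= [_ hw] S0]; split=> // i /andP[i0 lin]; apply: S0; rewrite i0 leqW.
Qed.

Lemma pr_path_ev_step_ge n p (C : set Omega) : measurable C ->
  \sum_(g <- nxt (head f p)) pr P (path_ev n.+1 (g :: p) `&` C) <=
  pr P (path_ev n p `&` C).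
Proof.
move=> mC.
have mE g : measurable (path_ev n.+1 (g :: p) `&` C) by exact: measurableI.
rewrite -(@pr_bigsetU _ _ _ P _ _ (fun g => path_ev n.+1 (g :: p) `&` C))//.
  apply: pr_le; [exact: bigsetU_measurable|exact: measurableI|].
  rewrite -bigcup_seq => w [g /= _ [Ew Cw]]; split => //; exact: path_ev_sub Ew.
by move=> g g' w _ _ [[/= [<- _] _] _] [[/= [<- _] _] _].
Qed.

(** Summing over the next state in [nxt] bounds from below both this probability and that of the
    complementary event [hold <= s]. The two bounds already add up to [arrived n p u], so both are
    attained; events outside [nxt] need no description. *)
Lemma path_ev_hold_law n p u s : p \in paths n -> 0 <= s ->
  pr P (path_ev n p `&` [set w | (jumpt n w <= u%:E)%E] `&`
    [set w | (s%:E < hold n.+1 w)%E]) =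
  arrived n p u * expR (- q (head f p) * s).
Proof.
move=> pn s0; have sp := size_paths pn.
set B := [set w | (jumpt n w <= u%:E)%E]; set C := [set w | (s%:E < hold n.+1 w)%E].
have mB : measurable B by exact: mjle.
have mC : measurable C by exact: mhlt.
have h1 : arrived n p u * expR (- q (head f p) * s) <= pr P (path_ev n p `&` B `&` C).
  rewrite -setIA; apply: le_trans (pr_path_ev_step_ge _ _ (measurableI _ _ mB mC)).
  under eq_bigr do rewrite setIA path_ev_step_law//.
  by rewrite -!big_distrl/= (Pi_sum pn) mul1r.
have h2 : arrived n p u * (1 - expR (- q (head f p) * s)) <=
    pr P (path_ev n p `&` B `\` C).
  rewrite setDE -setIA; apply: le_trans (pr_path_ev_step_ge _ _ _); last first.
    by apply: measurableI => //; exact: measurableC.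
  under eq_bigr => g _.
    rewrite setIA -setDE.
    have := @pr_split _ _ _ P (path_ev n.+1 (g :: p) `&` B) C.
    rewrite path_ev_step_law// path_ev_step_arrived// => e.
    rewrite (_ : pr _ _ = Pi (head f p) g *
      (arrived n p u * (1 - expR (- q (head f p) * s)))); last first.
      have {}e := e (measurableI _ _ (mpath _ _) mB) mC; lra.
    over.
  by rewrite -big_distrl/= (Pi_sum pn) mul1r.
have := @pr_split _ _ _ P (path_ev n p `&` B) C (measurableI _ _ (mpath _ _) mB) mC.
by rewrite -/(arrived n p u) => h3; lra.
Qed.

Lemma arrived_le n p u u' : u <= u' -> arrived n p u <= arrived n p u'.
Proof.
move=> uu'; apply: pr_le; [exact: measurableI|exact: measurableI|].
by move=> w [? /= ju]; split => //=; apply: le_trans ju _; rewrite lee_fin.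
Qed.

Lemma occupied_ge0 n p t : 0 <= occupied n p t.
Proof. exact: pr_ge0. Qed.

Lemma occupied_le1 n p t : occupied n p t <= 1.
Proof. by apply: pr_le1; apply: measurableI => //; exact: measurableI. Qed.

Lemma occupied_shift n p t h : p \in paths n -> 0 <= t -> 0 <= h ->
  pr P (path_ev n p `&` [set w | (jumpt n w <= t%:E)%E] `&`
    [set w | ((t + h)%:E < jumpt n.+1 w)%E]) =
  expR (- q (head f p) * h) * occupied n p t.
Proof.
move=> pn t0 h0.
have := @two_clocks_memoryless _ _ _ P (jumpt n) (hold n.+1) (q (head f p))
  (arrived n p) (measurable_jumpt n) (measurable_hold n.+1) (jumpt_ge0 n)
  (path_ev n p) (path_ev n p) 1 t h (mpath _ _) (mpath _ _) (q_ge0 _) ler01 t0 h0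
  (@arrived_le n p).
rewrite !mul1r; apply; move=> u s s0; rewrite ?mul1r; exact: path_ev_hold_law.
Qed.

(** Memorylessness with [h = 0] and [c] the transition probability: the choice of the next state
    does not influence how long the current one is held. *)
Lemma occupied_step n p g t : p \in paths n -> 0 <= t ->
  pr P (path_ev n.+1 (g :: p) `&` [set w | (jumpt n w <= t%:E)%E] `&`
    [set w | (t%:E < jumpt n.+1 w)%E]) =
  Pi (head f p) g * occupied n p t.
Proof.
move=> pn t0.
have := @two_clocks_memoryless _ _ _ P (jumpt n) (hold n.+1) (q (head f p))
  (arrived n p) (measurable_jumpt n) (measurable_hold n.+1) (jumpt_ge0 n)
  (path_ev n.+1 (g :: p)) (path_ev n p) (Pi (head f p) g) t 0
  (mpath _ _) (mpath _ _) (q_ge0 _) (Pi_ge0 _ _) t0 (lexx 0)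
  (@arrived_le n p).
rewrite addr0 mulr0 expR0 mulr1; apply; move=> u s s0.
  by apply: path_ev_step_law => //; exact: size_paths pn.
exact: path_ev_hold_law.
Qed.

(** To complete [g :: p] by time [t] is to complete [p], leave its end by time [t], and choose
    [g]. *)
Lemma arrived_step n p g t : p \in paths n -> 0 <= t ->
  arrived n.+1 (g :: p) t = Pi (head f p) g * (arrived n p t - occupied n p t).
Proof.
move=> pn t0; have sp := size_paths pn.
have := @pr_split _ _ _ P (path_ev n.+1 (g :: p) `&` [set w | (jumpt n w <= t%:E)%E])
  [set w | (t%:E < jumpt n.+1 w)%E] (measurableI _ _ (mpath _ _) (mjle _ _)) (mjlt _ _).
rewrite path_ev_step_arrived// occupied_step//.
rewrite (_ : _ `\` _ = path_ev n.+1 (g :: p) `&` [set w | (jumpt n.+1 w <= t%:E)%E]).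
  by rewrite -/(arrived n.+1 (g :: p) t) => h; lra.
apply/seteqP; split => w.
  by move=> [[Ew _] /negP]; rewrite -leNgt.
move=> [Ew /= jt]; split; last by apply/negP; rewrite -leNgt.
by split => //=; apply: le_trans jt; rewrite leeDl// hold_ge0.
Qed.

(** Mass present at time [t] survives with the exponential factor. Arrivals between [t] and [t + h]
    contribute at most all of themselves, and at least those whose next holding time exceeds [h]. *)
Lemma occupied_increment n p t h : p \in paths n -> 0 <= t -> 0 <= h ->
  expR (- q (head f p) * h) * (arrived n p (t + h) - arrived n p t) <=
  occupied n p (t + h) - expR (- q (head f p) * h) * occupied n p t <=
  arrived n p (t + h) - arrived n p t.
Proof.
move=> pn t0 h0; set E := path_ev n p.
set B := [set w | (jumpt n w <= t%:E)%E]; set B' := [set w | (jumpt n w <= (t + h)%:E)%E].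
have BB' : B `<=` B' by move=> w /= ju; apply: le_trans ju _; rewrite lee_fin lerDl.
have mE : measurable E by exact: mpath.
have mB : measurable B by exact: mjle.
have mB' : measurable B' by exact: mjle.
have split_le C : measurable C -> pr P (E `&` B' `&` C) =
    pr P (E `&` B `&` C) + pr P ((E `&` B' `&` C) `\` B).
  move=> mC; rewrite (@pr_split _ _ _ P (E `&` B' `&` C) B)//; last first.
    by apply: measurableI => //; exact: measurableI.
  congr (pr P _ + _); apply/seteqP; split => w; first by move=> [[[? ?] ?] ?].
  by move=> [[? Bw] ?]; do !split => //; exact: BB'.
have eq1 := split_le _ (mjlt n.+1 (t + h)).
rewrite occupied_shift// in eq1.
have eq2 := split_le _ (mhlt n.+1 h); rewrite !path_ev_hold_law// in eq2.
have eq3 := split_le _ measurableT.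
rewrite !setIT -/(arrived n p t) -/(arrived n p (t + h)) in eq3.
have mI C : measurable C -> measurable ((E `&` B' `&` C) `\` B).
  by move=> mC; apply: measurableD => //; apply: measurableI => //; exact: measurableI.
have l1 : pr P ((E `&` B' `&` [set w | ((t + h)%:E < jumpt n.+1 w)%E]) `\` B) <=
    pr P ((E `&` B') `\` B).
  apply: pr_le; [exact: mI|by apply: measurableD => //; exact: measurableI|].
  by apply: setSD => w [].
have l2 : pr P ((E `&` B' `&` [set w | (h%:E < hold n.+1 w)%E]) `\` B) <=
    pr P ((E `&` B' `&` [set w | ((t + h)%:E < jumpt n.+1 w)%E]) `\` B).
  apply: pr_le; [exact: mI|exact: mI|].
  move=> w [[EBw /= hw] nB]; split => //; split => //=.
  rewrite EFinD; apply: lteD => //.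
  by move: nB => /= /negP; rewrite -ltNge.
rewrite -/(occupied n p (t + h)) in eq1.
rewrite eq1; apply/andP; split; lra.
Qed.

(** The two bounds of [occupied_increment] differ by a fraction at most [q * h] of the new arrivals,
    which are themselves [O(h)]; this is a second order remainder. *)
Lemma C11_occupied n p v : p \in paths n -> C11 (arrived n p) v ->
  C11 (occupied n p) (fun t => - q (head f p) * occupied n p t + v t).
Proof.
move=> pn [C hC]; set a := q (head f p).
have a0 : 0 <= a by exact: q_ge0.
have C0 : 0 <= C.
  by have [_ + _] := hC 0 1 (lexx _) ler01; rewrite mulr1; exact: le_trans.
have lip t h : 0 <= t -> 0 <= h -> `|occupied n p (t + h) - occupied n p t| <= (a + C) * h.
  move=> t0 h0; have := occupied_increment pn t0 h0; rewrite -/a.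
  have [_ + _] := hC _ _ t0 h0 => /(le_trans (ler_norm _)).
  have dA : 0 <= arrived n p (t + h) - arrived n p t by rewrite subr_ge0 arrived_le// lerDl.
  have := occupied_ge0 n p t; have := occupied_le1 n p t.
  have := expRN_ge1B (a * h); rewrite -mulNr => e1 o1 o0 lA /andP[l1 l2].
  have ah0 : 0 <= a * h by rewrite mulr_ge0.
  have e2 : expR (- a * h) <= 1 by rewrite -expR0 ler_expR mulNr oppr_le0.
  have e0 := expR_ge0 (- a * h).
  have l3 : 0 <= expR (- a * h) * (arrived n p (t + h) - arrived n p t) by rewrite mulr_ge0.
  have m0 : 0 <= (1 - expR (- a * h)) * occupied n p t by rewrite mulr_ge0// subr_ge0.
  have m1 : (1 - expR (- a * h)) * occupied n p t <= 1 - expR (- a * h).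
    by rewrite ler_piMr// subr_ge0.
  have Ch0 : 0 <= C * h by rewrite mulr_ge0.
  by rewrite ler_norml; apply/andP; split; lra.
exists (a ^+ 2 + a * C + C + a + a * (a + C)) => t h t0 h0.
have [q1 l1 d1] := hC _ _ t0 h0.
have aC0 : 0 <= a * C by rewrite mulr_ge0.
have aaC0 : 0 <= a * (a + C) by rewrite mulr_ge0// addr_ge0.
have a20 : 0 <= a ^+ 2 by exact: exprn_ge0.
split.
- have dA : 0 <= arrived n p (t + h) - arrived n p t by rewrite subr_ge0 arrived_le// lerDl.
  have := occupied_increment pn t0 h0; rewrite -/a => /andP[i1 i2].
  have ah0 : 0 <= a * h by rewrite mulr_ge0.
  have := expRN_quad ah0; rewrite -mulNr => eq_.
  have := expRN_ge1B (a * h); rewrite -mulNr => e1.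
  have l1' := le_trans (ler_norm _) l1.
  set e := expR (- a * h) in i1 i2 eq_ e1 *.
  set dF := arrived n p (t + h) - arrived n p t in dA i1 i2 l1' q1 *.
  set th := occupied n p (t + h) - e * occupied n p t in i1 i2 *.
  rewrite (_ : _ - _ - _ = (e - 1 + a * h) * occupied n p t + (th - dF) +
    (dF - h * v t)); last by rewrite /th; ring.
  have b1 : `|(e - 1 + a * h) * occupied n p t| <= a ^+ 2 * h ^+ 2.
    rewrite normrM -exprMn (ger0_norm (occupied_ge0 _ _ _)).
    apply: le_trans eq_; rewrite ler_piMr//; exact: occupied_le1.
  have b2 : `|th - dF| <= a * C * h ^+ 2.
    rewrite ler_norml; apply/andP; split; last first.
      by apply: (@le_trans _ _ 0); [lra|rewrite mulr_ge0// exprn_ge0].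
    have : (1 - e) * dF <= a * h * (C * h).
      apply: (@le_trans _ _ (a * h * dF)); first by rewrite ler_wpM2r//; lra.
      by rewrite ler_wpM2l.
    by lra.
  apply: (le_trans (ler_normD _ _)); apply: (le_trans (lerD (ler_normD _ _) (lexx _))).
  have h20 : 0 <= h ^+ 2 by exact: exprn_ge0.
  have z1 : 0 <= a * h ^+ 2 by rewrite mulr_ge0.
  have z2 : 0 <= a * (a + C) * h ^+ 2 by rewrite mulr_ge0.
  by lra.
- apply: (le_trans (lip _ _ t0 h0)); rewrite ler_wpM2r//; lra.
- rewrite (_ : _ - _ = - a * (occupied n p (t + h) - occupied n p t) +
    (v (t + h) - v t)); last by ring.
  apply: (le_trans (ler_normD _ _)); rewrite normrM normrN (ger0_norm a0).
  apply: (le_trans (lerD (ler_wpM2l a0 (lip _ _ t0 h0)) d1)).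
  rewrite mulrA -mulrDl ler_wpM2r//; lra.
Qed.

Definition arrival_rate n p t : R :=
  match n, p with
  | n'.+1, g :: p' => Pi (head f p') g * q (head f p') * occupied n' p' t
  | _, _ => 0
  end.

(** With [v] the derivative for the shorter path, [arrived_step] gives the derivative
    [Pi * (v - (- q * occupied + v))]: [v] cancels, and the induction closes with an explicit
    rate. *)
Lemma C11_arrived n p : p \in paths n -> C11 (arrived n p) (arrival_rate n p).
Proof.
elim: n p => [|n IH] p.
  move=> _; apply: (C11_cst (c := pr P (path_ev 0 p))) => t t0.
  rewrite /arrived (_ : _ `&` _ = path_ev 0 p)//; apply/setIidPl => w _ /=.
  by rewrite lee_fin.
move=> /allpairsPdep[p' [g [p'n _ ->]]] /=.
have c1 := IH _ p'n; have c2 := C11_occupied p'n c1.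
apply: (C11_ext (C11Z (Pi (head f p') g) (C11D c1 (C11Z (-1) c2)))) => t t0.
  by rewrite arrived_step//; ring.
by rewrite [RHS]/=; ring.
Qed.

Lemma C11_occupied_paths n p : p \in paths n ->
  C11 (occupied n p) (fun t => - q (head f p) * occupied n p t + arrival_rate n p t).
Proof. by move=> pn; apply: C11_occupied => //; exact: C11_arrived. Qed.

(** * Truncation by the number of jumps: moments, tails, non-explosion *)

Variable K : R.
Hypothesis q_le : forall n p, p \in paths n -> q (head f p) <= K * n.+1%:R.

Let K_ge0 : 0 <= K.
Proof.
have /= := @q_le 0%N [:: f] (mem_head _ _); rewrite mulr1; exact: le_trans.
Qed.

Definition level n (phi : T -> R) t : R :=
  \sum_(p <- paths n) phi (head f p) * occupied n p t.

(** Here [phi] may depend on the number of jumps, so that the jump counter itself can serve as test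
    function. *)
Definition upto N (phi : nat -> T -> R) t : R :=
  \sum_(0 <= n < N.+1) level n (phi n) t.

Definition jump_mean (phi : T -> R) g : R := \sum_(g' <- nxt g) Pi g g' * phi g'.

Lemma eq_level n phi psi t : (forall p, p \in paths n -> phi (head f p) = psi (head f p)) ->
  level n phi t = level n psi t.
Proof. by move=> e; apply: eq_big_seq => p pn; rewrite e. Qed.

Lemma le_level n phi psi t : (forall p, p \in paths n -> phi (head f p) <= psi (head f p)) ->
  level n phi t <= level n psi t.
Proof.
move=> e; rewrite /level big_seq [leRHS]big_seq; apply: ler_sum => p pn.
by rewrite ler_wpM2r ?occupied_ge0// e.
Qed.

Lemma levelZ n phi c t : level n (fun g => c * phi g) t = c * level n phi t.
Proof. by rewrite /level mulr_sumr; apply: eq_bigr => p _; rewrite mulrA. Qed.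

Lemma levelB n phi psi t :
  level n (fun g => phi g - psi g) t = level n phi t - level n psi t.
Proof. by rewrite /level -sumrB; apply: eq_bigr => p _; rewrite mulrBl. Qed.

Lemma level_ge0 n phi t : (forall p, p \in paths n -> 0 <= phi (head f p)) ->
  0 <= level n phi t.
Proof.
move=> h; rewrite /level big_seq; apply: sumr_ge0 => p pn.
by rewrite mulr_ge0 ?occupied_ge0// h.
Qed.

Lemma level_norm_le n phi c t : (forall p, p \in paths n -> `|phi (head f p)| <= c) ->
  `|level n phi t| <= c * level n (fun=> 1) t.
Proof.
move=> h; rewrite -levelZ; apply: (le_trans (ler_norm_sum _ _ _)).
rewrite /level big_seq [leRHS]big_seq; apply: ler_sum => p pn.
by rewrite normrM (ger0_norm (occupied_ge0 _ _ _)) ler_wpM2r ?occupied_ge0// mulr1 h.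
Qed.

Lemma jump_mean_cst c n p : p \in paths n -> jump_mean (fun=> c) (head f p) = c.
Proof. by move=> pn; rewrite /jump_mean -big_distrl/= (Pi_sum pn) mul1r. Qed.

Lemma jump_mean_norm_le n p phi c : p \in paths n ->
  (forall p', p' \in paths n.+1 -> `|phi (head f p')| <= c) ->
  `|jump_mean phi (head f p)| <= c.
Proof.
move=> pn h; rewrite -(jump_mean_cst c pn); apply: (le_trans (ler_norm_sum _ _ _)).
rewrite /jump_mean big_seq [leRHS]big_seq; apply: ler_sum => g gn.
rewrite normrM (ger0_norm (Pi_ge0 _ _)) ler_wpM2l//.
by apply: (h (g :: p)); apply: allpairs_f_dep.
Qed.

Lemma C11_level n phi : C11 (level n phi)
  (fun t => - level n (fun g => q g * phi g) t +
    if n is n'.+1 then level n' (fun g => q g * jump_mean phi g) t else 0).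
Proof.
have := @C11_sum R _ (paths n) (fun p t => phi (head f p) * occupied n p t)
  (fun p t => phi (head f p) * (- q (head f p) * occupied n p t + arrival_rate n p t)).
move=> /(_ (fun p pn => C11Z _ (C11_occupied_paths pn))) h.
apply: (C11_ext h) => // t t0.
rewrite (_ : - level _ _ t =
  \sum_(p <- paths n) phi (head f p) * (- q (head f p) * occupied n p t)); last first.
  by rewrite /level -sumrN; apply: eq_bigr => p _; ring.
under eq_bigr do rewrite mulrDr; rewrite big_split/=; congr (_ + _).
case: n {h} => [|n] /=; first by rewrite big_seq1 mulr0.
rewrite big_allpairs_dep /= /level; apply: eq_bigr => p _.
by rewrite /jump_mean mulr_sumr mulr_suml; apply: eq_bigr => g _; ring.
Qed.

Definition generator (phi : nat -> T -> R) n g : R :=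
  q g * (jump_mean (phi n.+1) g - phi n g).

(** Losses and gains of consecutive levels combine into the generator. The subtracted term is the
    flow out of level [N], whose gain belongs to the discarded level [N.+1]. *)
Lemma C11_upto N phi : C11 (upto N phi)
  (fun t => upto N (generator phi) t - level N (fun g => q g * jump_mean (phi N.+1) g) t).
Proof.
have genE n t : level n (generator phi n) t =
    level n (fun g => q g * jump_mean (phi n.+1) g) t - level n (fun g => q g * phi n g) t.
  by rewrite -levelB; apply: eq_level => p _; rewrite /generator mulrBr.
elim: N => [|N IH].
  apply: (C11_ext (C11_level 0 (phi 0%N))) => t t0; rewrite /upto big_nat1//.
  by rewrite genE; ring.
apply: (C11_ext (C11D IH (C11_level N.+1 (phi N.+1)))) => t t0.
  by rewrite /upto [RHS]big_nat_recr.
by rewrite /upto [in RHS]big_nat_recr//= genE; ring.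
Qed.

Lemma occupied_at0 n p : occupied n.+1 p 0 = 0.
Proof.
rewrite /occupied (_ : _ `&` _ `&` _ = set0) ?/pr ?measure0//.
apply/seteqP; split => // w [[[_ S0] /= j0] _].
have : (0 < jumpt n w + hold n.+1 w)%E.
  apply: (@lt_le_trans _ _ (hold n.+1 w)); last by rewrite leeDr// jumpt_ge0.
  by rewrite hold_gt0E; apply: S0; rewrite /= leqnn.
by rewrite ltNge j0.
Qed.

Lemma occupied0_at0 : occupied 0 [:: f] 0 = 1.
Proof.
have := path_ev_hold_law 0 (mem_head _ _ : [:: f] \in paths 0) (lexx 0).
rewrite mulr0 expR0 mulr1 /occupied.
have -> : [set w | (0%:E < jumpt 1 w)%E] = [set w | (0%:E < hold 1 w)%E].
  by apply/seteqP; split => w /=; rewrite add0e.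
move=> ->.
have := @law 0%N (fun=> f) (fun=> 0) (fun=> lexx 0).
rewrite big_nil mulr1; case: asboolP => // _ h.
rewrite /arrived /pr (_ : _ `&` _ = [set w | forall i, (i <= 0)%N -> Y i w = f] `&`
     [set w | forall i, (1 <= i <= 0)%N -> (0%:E < S i w)%E]) ?h//.
apply/seteqP; split => w /=.
  by move=> [[[Y0] S0] _]; split => // -[].
by move=> [Y0 S0]; split => //; split => //=; rewrite Y0.
Qed.

Lemma upto_at0 N phi : upto N phi 0 = phi 0%N f.
Proof.
rewrite /upto big_nat_recl//= big1 ?addr0.
  by rewrite /level /= big_seq1 occupied0_at0 mulr1.
by move=> n _; rewrite /level big1// => p _; rewrite occupied_at0 mulr0.
Qed.

Definition growth t : R := expR (7 * K * t).

(* the jump counter has a bounded third moment, since its jump rate from [n]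
   is at most [K * n.+1] *)
Lemma third_moment N t : 0 <= t ->
  upto N (fun n _ => n.+1%:R ^+ 3) t <= growth t.
Proof.
move=> t0; set phi := fun n (_ : T) => n.+1%:R ^+ 3 : R.
have phi0 n g : 0 <= phi n g by exact: exprn_ge0.
have := C11_gronwall (C11_upto N phi) (mulr_ge0 (ler0n R 7) K_ge0) _ _ t0.
rewrite upto_at0 /phi expr1n mulr1; apply=> s s0.
  by apply: sumr_ge0 => n _; apply: level_ge0 => p _; exact: phi0.
rewrite lerBlDr; apply: (@le_trans _ _ (7 * K * upto N phi s)); last first.
  rewrite lerDl; apply: level_ge0 => p pN.
  by rewrite (jump_mean_cst _ pN) mulr_ge0.
rewrite /upto mulr_sumr; apply: ler_sum => n _; rewrite -levelZ.
apply: le_level => p pn; rewrite /generator (jump_mean_cst _ pn).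
have x1 : 1 <= n.+1%:R :> R by rewrite ler1n.
rewrite /phi -[n.+2%:R]natr1; set x : R := n.+1%:R in x1 *.
apply: (@le_trans _ _ (K * x * (7 * x ^+ 2))).
  (* For [1 <= x] the difference [3 * x ^+ 2 + 3 * x + 1] is at most [7 * x ^+ 2]: the origin of the
     [7] in [growth]. *)
  have h7 : (x + 1) ^+ 3 - x ^+ 3 <= 7 * x ^+ 2 by nra.
  have h0 : 0 <= (x + 1) ^+ 3 - x ^+ 3 by nra.
  by apply: ler_pM => //; exact: q_le.
by rewrite le_eqVlt; apply/orP; left; apply/eqP; ring.
Qed.

Lemma level1_ge0 n t : 0 <= level n (fun=> 1) t.
Proof. exact: level_ge0. Qed.

(** Markov's inequality: from level [N] on, a spare factor [n.+1 >= N.+1] completes the square to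
    the third moment. *)
Lemma tail_le N M t phi C : 0 <= t -> 0 <= C ->
  (forall n p, p \in paths n -> `|phi n (head f p)| <= C * n.+1%:R ^+ 2) ->
  \sum_(N <= n < M.+1) `|level n (phi n) t| <= C * growth t / N.+1%:R.
Proof.
move=> t0 C0 hphi; rewrite ler_pdivlMr ?ltr0Sn//.
have [NM|MN] := leqP N M.+1; last by rewrite big_geq ?mul0r ?mulr_ge0 ?expR_ge0// ltnW.
apply: (@le_trans _ _ (C * upto M (fun n _ => n.+1%:R ^+ 3) t)); last first.
  by rewrite ler_wpM2l// third_moment.
rewrite /upto [in leRHS](@big_cat_nat _ _ _ N)//= mulrDr -[leLHS]add0r; apply: lerD.
  rewrite mulr_ge0// sumr_ge0// => n _; apply: level_ge0 => p _; exact: exprn_ge0.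
rewrite mulr_suml mulr_sumr; apply: ler_sum_nat => n /andP[Nn _].
apply: (@le_trans _ _ (C * n.+1%:R ^+ 2 * level n (fun=> 1) t * N.+1%:R)).
  by rewrite ler_wpM2r// level_norm_le// => p pn; exact: hphi.
have -> : level n (fun=> n.+1%:R ^+ 3) t = n.+1%:R ^+ 3 * level n (fun=> 1) t.
  by rewrite -levelZ; apply: eq_level => p _; rewrite mulr1.
have L0 := level1_ge0 n t.
have Nn' : N.+1%:R <= n.+1%:R :> R by rewrite ler_nat.
apply: (@le_trans _ _ (C * n.+1%:R ^+ 2 * level n (fun=> 1) t * n.+1%:R)).
  by rewrite ler_wpM2l// !mulr_ge0// exprn_ge0.
by rewrite le_eqVlt; apply/orP; left; apply/eqP; ring.
Qed.

Lemma level_le N t phi C : 0 <= t -> 0 <= C ->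
  (forall n p, p \in paths n -> `|phi n (head f p)| <= C * n.+1%:R ^+ 2) ->
  `|level N (phi N) t| <= C * growth t / N.+1%:R.
Proof. by move=> t0 C0 h; have := tail_le N N t0 C0 h; rewrite big_nat1. Qed.

Lemma growth_le s t : s <= t -> growth s <= growth t.
Proof. by move=> st; rewrite ler_expR ler_wpM2l// mulr_ge0. Qed.

(** The generator kills constants, so the mass on at most [N] jumps changes only through the flow
    out of level [N]. *)
Lemma no_explosion N t : 0 <= t ->
  1 - upto N (fun _ _ => 1) t <= K * growth t * t / N.+1%:R.
Proof.
move=> t0.
have := C11_norm_le (c := 0) (e := K * growth t / N.+1%:R)
  (C11_upto N (fun _ _ => 1)) (lexx 0) t0 _.
rewrite upto_at0 mul0r !subr0 => h.
suff : `|upto N (fun _ _ => 1) t - 1| <= K * growth t / N.+1%:R * t.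
  by rewrite ler_norml => /andP[h1 _]; rewrite [leRHS]mulrAC -opprB lerNl.
apply: h => s s0 st; rewrite subr0 (_ : upto N _ s = 0) ?sub0r ?normrN; last first.
  rewrite /upto big1// => n _; rewrite /level big_seq big1// => p pn.
  by rewrite /generator (jump_mean_cst _ pn) subrr mulr0 mul0r.
apply: (@le_trans _ _ (K * growth s / N.+1%:R)); last first.
  by rewrite ler_wpM2r// ler_wpM2l// growth_le.
apply: (@level_le N s (fun n g => q g * jump_mean (fun=> 1) g)) => // n p pn.
rewrite (jump_mean_cst _ pn) mulr1 ger0_norm//; apply: (le_trans (q_le pn)).
by rewrite ler_wpM2l// expr2 ler_peMl// ler1n.
Qed.

(** * From sums over paths to expectations of the process *)

Variable X : R -> Omega -> T.
Hypothesis X_jump : forall w t n, 0 <= t -> (jtime S n w <= t%:E)%E ->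
  (t%:E < jtime S n.+1 w)%E -> X t w = Y n w.

Definition piece n p t : set Omega :=
  path_ev n p `&` [set w | (jumpt n w <= t%:E)%E] `&`
    [set w | (t%:E < jumpt n.+1 w)%E].

Definition block n t : set Omega := \big[setU/set0]_(p <- paths n) piece n p t.

Lemma jtime_jumpt n w : (forall i, (1 <= i <= n)%N -> (0 < S i w)%E) ->
  jtime S n w = jumpt n w.
Proof.
rewrite /jtime; elim: n => [_|n IH S0] /=; first by rewrite big_geq.
rewrite big_nat_recr//= IH; last by move=> i /andP[i0 lin]; apply: S0; rewrite i0 leqW.
by rewrite hold_gt0E//; apply: S0; rewrite /= leqnn.
Qed.

Lemma X_piece n p t w : 0 <= t -> piece n p t w -> X t w = head f p.
Proof.
move=> t0 [[[/= hw S0] j1] j2].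
(* [path_ev] says nothing about the next holding time, but [jumpt n <= t < jumpt n.+1] forces it to
   be positive; hence [jtime] and [jumpt] agree up to [n.+1]. *)
have S1 : (0 < S n.+1 w)%E.
  rewrite ltNge; apply/negP => S1; move: j2; rewrite /hold max_r// adde0.
  by rewrite ltNge j1.
rewrite (X_jump (n := n))//.
- by rewrite -hw; case: (n).
- by rewrite jtime_jumpt.
- rewrite jtime_jumpt// => i /andP[i0]; rewrite leq_eqVlt => /predU1P[->//|].
  by rewrite ltnS => lin; apply: S0; rewrite i0.
Qed.

Lemma measurable_piece n p t : measurable (piece n p t).
Proof. by apply: measurableI => //; exact: measurableI. Qed.

Lemma measurable_block n t : measurable (block n t).
Proof. by apply: bigsetU_measurable => p _; exact: measurable_piece. Qed.

Lemma piece_inj n p p' t w : piece n p t w -> piece n p' t w -> p = p'.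
Proof. by move=> [[[/= <- _] _] _] [[[/= <- _] _] _]. Qed.

Lemma block_jumpt n t w : block n t w ->
  (jumpt n w <= t%:E)%E /\ (t%:E < jumpt n.+1 w)%E.
Proof. by rewrite /block -bigcup_seq => -[p _ [[_ ?] ?]]. Qed.

Lemma jumpt_le n m w : (n <= m)%N -> (jumpt n w <= jumpt m w)%E.
Proof.
move=> /subnK <-; elim: (m - n)%N => //= i IH.
by apply: (le_trans IH); rewrite leeDl// hold_ge0.
Qed.

Lemma block_inj n m t w : block n t w -> block m t w -> n = m.
Proof.
move=> /block_jumpt[n1 n2] /block_jumpt[m1 m2].
have [nm|mn|//] := ltngtP n m.
- by have := le_lt_trans (le_trans (jumpt_le w nm) m1) n2; rewrite ltxx.
- by have := le_lt_trans (le_trans (jumpt_le w mn) n1) m2; rewrite ltxx.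
Qed.

Lemma trivIset_block t : trivIset setT (block^~ t).
Proof. by move=> n m _ _ [w [wn wm]]; exact: block_inj wn wm. Qed.

Lemma pr_block n t : pr P (block n t) = level n (fun=> 1) t.
Proof.
rewrite /block pr_bigsetU.
- by apply: eq_bigr => p _; rewrite mul1r.
- exact: uniq_paths.
- by move=> p; exact: measurable_piece.
- by move=> p p' w _ _; exact: piece_inj.
Qed.

Definition blocks t : set Omega := \bigcup_n block n t.

Lemma measurable_blocks t : measurable (blocks t).
Proof. by apply: bigcupT_measurable => n; exact: measurable_block. Qed.

(** The blocks are disjoint and exhaust the probability by [no_explosion]. Outside them the value of
    [X] may be unspecified, so expectations are computed on [blocks t]. *)
Lemma blocks_full t : 0 <= t -> P (~` blocks t) = 0%E.
Proof.
move=> t0; have mD := measurable_blocks t.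
rewrite prE; last exact: measurableC.
have e1 : 1 = pr P (blocks t) + pr P (~` blocks t).
  by rewrite -setTD -[in X in X + _](setTI (blocks t)) -pr_split// /pr probability_setT.
congr EFin; apply/eqP; rewrite eq_le pr_ge0 andbT.
apply: (@le0_of_le_divn _ _ (K * growth t * t)) => N.
apply: le_trans (no_explosion N t0).
suff : upto N (fun _ _ => 1) t <= pr P (blocks t) by lra.
rewrite /upto; under eq_bigr do rewrite -pr_block.
rewrite -(@pr_bigsetU _ _ _ P nat _ (block^~ t)) ?iota_uniq//.
- apply: pr_le => //.
    by apply: bigsetU_measurable => n _; exact: measurable_block.
  by rewrite -bigcup_seq => w [n _ ?]; exists n.
- by move=> n; exact: measurable_block.
- by move=> n m w _ _; exact: block_inj.
Qed.

Lemma integral_block n t (psi : T -> R) : 0 <= t ->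
  measurable_fun setT (fun w => psi (X t w)) ->
  (\int[P]_(w in block n t) (psi (X t w))%:E = (level n psi t)%:E)%E.
Proof.
move=> t0 mpsi; rewrite /block integral_bigsetU_EFin.
- rewrite /level -sumEFin; apply: eq_bigr => p _.
  rewrite (eq_integral (fun=> (psi (head f p))%:E)); last first.
    by move=> w /set_mem /(X_piece t0) ->.
  have mp := measurable_piece n p t.
  by rewrite integral_cst//= prE// -EFinM.
- by move=> p; exact: measurable_piece.
- exact: uniq_paths.
- by move=> p p' _ _ [w [wp wp']]; exact: piece_inj wp wp'.
- by apply/measurable_EFinP; exact: measurable_funS mpsi.
Qed.

Lemma sum_level_norm_le (psi : T -> R) (C : R) t N : 0 <= C -> 0 <= t ->
  (forall n p, p \in paths n -> `|psi (head f p)| <= C * n.+1%:R) ->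
  \sum_(0 <= n < N) `|level n psi t| <= C * growth t.
Proof.
move=> C0 t0 psi_le; case: N => [|N].
  by rewrite big_geq// mulr_ge0// expR_ge0.
have := @tail_le 0%N N t (fun=> psi) C t0 C0; rewrite divr1; apply => n p pn.
by apply: (le_trans (psi_le n p pn)); rewrite ler_wpM2l// expr2 ler_peMl// ler1n.
Qed.

Section Mean.
Variables (psi : T -> R) (C : R).
Hypothesis mpsi : forall t, measurable_fun setT (fun w => psi (X t w)).
Hypothesis C_ge0 : 0 <= C.
Hypothesis psi_le : forall n p, p \in paths n -> `|psi (head f p)| <= C * n.+1%:R.

Let integrable_blocks t : 0 <= t ->
  P.-integrable (blocks t) (fun w => (psi (X t w))%:E).
Proof.
move=> t0; apply/integrableP; split.
  by apply/measurable_EFinP; apply: measurable_funS (mpsi t).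
have mabs : measurable_fun setT (fun w => `|psi (X t w)|).
  by apply: measurableT_comp => //; exact: mpsi.
rewrite ge0_integral_bigcup//=.
- apply: (@le_lt_trans _ _ (C * growth t)%:E); last by rewrite ltry.
  apply: lime_le.
    by apply: is_cvg_nneseries => n _ _; apply: integral_ge0.
  apply: nearW => N.
  under eq_bigr do rewrite (@integral_block _ t (fun g => `|psi g|))//=.
  rewrite sumEFin lee_fin.
  have psi_le' n p : p \in paths n -> `|(`|psi (head f p)|)| <= C * n.+1%:R.
    by rewrite normr_id; exact: psi_le.
  apply: le_trans (sum_level_norm_le N C_ge0 t0 psi_le').
  by apply: ler_sum => n _; exact: ler_norm.
- by move=> n; exact: measurable_block.
- by apply/measurable_EFinP; apply: measurable_funS mabs.
- exact: trivIset_block.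
Qed.

Lemma integrable_observable t : 0 <= t ->
  P.-integrable setT (fun w => (psi (X t w))%:E).
Proof.
move=> t0; have mD := measurable_blocks t.
apply/(negligible_integrable (measurableC mD)) => //.
- by apply/measurable_EFinP; exact: mpsi.
- exact: blocks_full.
- by rewrite setTD setCK; exact: integrable_blocks.
Qed.

Definition mean t : R := fine (\int[P]_w (psi (X t w))%:E)%E.

Lemma cvg_mean t : 0 <= t ->
  (\sum_(0 <= n < N) level n psi t) @[N --> \oo] --> mean t.
Proof.
move=> t0; have mD := measurable_blocks t.
have cv : cvgn (series (fun n => level n psi t)).
  apply: normed_cvg; apply: nondecreasing_is_cvgn.
    by apply: nondecreasing_series => *; exact: normr_ge0.
  exists (C * growth t) => _ [N _ <-]; exact: sum_level_norm_le.
suff -> : mean t = limn (series (fun n => level n psi t)) by [].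
rewrite /mean (negligible_integral (measurableC mD))//; last 2 first.
- exact: integrable_observable.
- exact: blocks_full.
rewrite setTD setCK integral_bigcup.
- rewrite (_ : (fun n => _) = EFin \o series (fun n => level n psi t)).
    by rewrite EFin_lim.
  apply/funext => N /=; rewrite /series/= -sumEFin; apply: eq_bigr => n _.
  by rewrite integral_block.
- exact: trivIset_block.
- by move=> n; exact: measurable_block.
- exact: integrable_blocks.
Qed.

Lemma mean_approx N t : 0 <= t ->
  `|mean t - upto N (fun=> psi) t| <= C * growth t / N.+1%:R.
Proof.
move=> t0; apply/ler_addgt0Pr => e e0.
have /cvgrPdist_le /(_ e e0) [M0 _ hM0] := cvg_mean t0.
pose M := maxn M0 N.+1.
have := hM0 M (leq_maxl _ _); rewrite /= => h1.
rewrite (_ : mean t - _ = (mean t - \sum_(0 <= n < M) level n psi t) +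
  (\sum_(0 <= n < M) level n psi t - upto N (fun=> psi) t)); last by ring.
rewrite [leRHS]addrC; apply: (le_trans (ler_normD _ _)); apply: lerD => //.
rewrite /upto (@big_cat_nat _ _ _ N.+1 0%N M)//= ?leq_maxr// addrAC subrr add0r.
apply: (le_trans (ler_norm_sum _ _ _)).
have M1 : (0 < M)%N by rewrite (leq_trans _ (leq_maxr _ _)).
have psi_le2 n p : p \in paths n -> `|psi (head f p)| <= C * n.+1%:R ^+ 2.
  move=> pn; apply: (le_trans (psi_le pn)).
  by rewrite ler_wpM2l// expr2 ler_peMl// ler1n.
rewrite -(prednK M1).
apply: (le_trans (@tail_le N.+1 M.-1 t (fun=> psi) C t0 C_ge0 psi_le2)).
rewrite ler_wpM2l ?mulr_ge0 ?expR_ge0// lef_pV2 ?posrE ?ltr0Sn// ler_nat.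
by [].
Qed.

Lemma mean_norm_le t : 0 <= t -> `|mean t| <= C * growth t.
Proof.
move=> t0; apply/ler_addgt0Pr => e e0.
have /cvgrPdist_le /(_ e e0) [M0 _ /(_ M0 (leqnn M0)) /= h1] := cvg_mean t0.
have h2 := le_trans (ler_norm_sum _ _ _) (sum_level_norm_le M0 C_ge0 t0 psi_le).
rewrite -[mean t](subrK (\sum_(0 <= n < M0) level n psi t)).
by apply: (le_trans (ler_normD _ _)); rewrite addrC lerD.
Qed.

End Mean.

(** * The Kolmogorov equation for expectations *)

Lemma growth_ge0 t : 0 <= growth t.
Proof. exact: expR_ge0. Qed.

(** The integrated Kolmogorov equation as an inequality, so that no time integral of a mean is
    formed. Every truncation satisfies it up to [O(1/N)], and [le0_of_le_divn] removes the error. *)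
Lemma mean_increment (psi chi : T -> R) (C c e s t : R) :
  (forall t, measurable_fun setT (fun w => psi (X t w))) ->
  (forall t, measurable_fun setT (fun w => chi (X t w))) -> 0 <= C ->
  (forall n p, p \in paths n -> `|psi (head f p)| <= C * n.+1%:R) ->
  (forall n p, p \in paths n -> `|chi (head f p)| <= C * n.+1%:R) ->
  (forall n p, p \in paths n ->
     q (head f p) * (jump_mean psi (head f p) - psi (head f p)) = chi (head f p)) ->
  0 <= s -> s <= t ->
  (forall r, s <= r -> r <= t -> `|mean chi r - c| <= e) ->
  `|mean psi t - mean psi s - c * (t - s)| <= e * (t - s).
Proof.
move=> mpsi mchi C0 psi_le chi_le gen s0 st hc; have t0 := le_trans s0 st.
have ts0 : 0 <= t - s by rewrite subr_ge0.
rewrite -subr_le0; set G := growth t.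
have G0 : 0 <= G by exact: growth_ge0.
(* [C * G] pays for truncating [mean chi]; [2 * (K * C) * G] for the boundary term, where [psi] is
   taken one jump later and [n.+2 <= 2 * n.+1]; [2 * (C * G)] for truncating [mean psi] at both
   ends. *)
apply: (@le0_of_le_divn _ _ ((C * G + 2 * (K * C) * G) * (t - s) + 2 * (C * G))) => N.
pose v r := upto N (generator (fun=> psi)) r -
  level N (fun g => q g * jump_mean psi g) r.
have B0 (b : R) r : 0 <= b -> r <= t -> b * growth r / N.+1%:R <= b * G / N.+1%:R.
  by move=> b0 rt; rewrite ler_wpM2r// ler_wpM2l// growth_le.
have hv r : s <= r -> r <= t ->
    `|v r - c| <= e + (C * G + 2 * (K * C) * G) / N.+1%:R.
  move=> sr rt; have r0 := le_trans s0 sr.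
  rewrite /v (_ : upto N _ r = upto N (fun=> chi) r); last first.
    by apply: eq_bigr => n _; apply: eq_level => p pn; rewrite /generator (gen n).
  have h1 := le_trans (mean_approx mchi C0 chi_le N r0) (B0 C r C0 rt).
  have h2 : `|level N (fun g => q g * jump_mean psi g) r| <= 2 * (K * C) * G / N.+1%:R.
    have KC0 : 0 <= 2 * (K * C) by rewrite !mulr_ge0.
    apply: le_trans (B0 _ r KC0 rt).
    apply: (@level_le N r (fun n g => q g * jump_mean psi g)) => // n p pn.
    rewrite normrM (ger0_norm (q_ge0 _)).
    apply: (@le_trans _ _ ((K * n.+1%:R) * (C * n.+2%:R))).
      apply: ler_pM => //; first exact: q_le.
      by apply: (jump_mean_norm_le pn) => p' pn'; exact: psi_le.
    rewrite (_ : _ * _ * _ = (K * C) * (n.+1%:R * n.+2%:R)); last by ring.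
    rewrite [leRHS](_ : _ = (K * C) * (n.+1%:R * (2 * n.+1%:R))); last by ring.
    rewrite ler_wpM2l ?mulr_ge0// ler_wpM2l// -[n.+2%:R]natr1.
    have : 1 <= n.+1%:R :> R by rewrite ler1n.
    by generalize (n.+1%:R : R) => x; lra.
  rewrite mulrDl addrA.
  rewrite (_ : _ - c = (mean chi r - c) - (mean chi r - upto N (fun=> chi) r)
    - level N (fun g => q g * jump_mean psi g) r); last by ring.
  apply: (le_trans (ler_normB _ _)); apply: lerD => //.
  by apply: (le_trans (ler_normB _ _)); apply: lerD => //; exact: hc.
have h1 := C11_norm_le (C11_upto N (fun=> psi)) s0 st hv.
have h2 := mean_approx mpsi C0 psi_le N t0.
have h3 := le_trans (mean_approx mpsi C0 psi_le N s0) (B0 C s C0 st).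
rewrite lerBlDl.
rewrite (_ : mean psi t - _ - _ = (upto N (fun=> psi) t - upto N (fun=> psi) s - c * (t - s))
   + (mean psi t - upto N (fun=> psi) t) - (mean psi s - upto N (fun=> psi) s)); last by ring.
apply: (le_trans (ler_normB _ _)); apply: (le_trans (lerD (ler_normD _ _) (lexx _))).
apply: (le_trans (lerD (lerD h1 h2) h3)).
rewrite le_eqVlt; apply/orP; left; apply/eqP; rewrite -/G.
by generalize (N.+1%:R^-1 : R) => x; ring.
Qed.

(** Linear growth is what the third moment can handle: multiplied by the rate, such a function is
    quadratic in the number of jumps. *)
Record observable (psi : T -> R) : Prop := Observable {
  observable_measurable : forall t, measurable_fun setT (fun w => psi (X t w));
  observable_growth : exists2 C, 0 <= C &
    forall n p, p \in paths n -> `|psi (head f p)| <= C * n.+1%:R }.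

Definition is_generator (psi chi : T -> R) := forall n p, p \in paths n ->
  q (head f p) * (jump_mean psi (head f p) - psi (head f p)) = chi (head f p).

(** [mean_increment] is used twice. The bound on [mean zeta] makes [mean chi] Lipschitz; then
    [c = mean chi s], with [e] proportional to [t - s], gives the second order expansion of
    [mean psi]. *)
Lemma mean_C11 (psi chi zeta : T -> R) tau :
  observable psi -> observable chi -> observable zeta ->
  is_generator psi chi -> is_generator chi zeta ->
  exists B, forall s t, 0 <= s -> s <= t -> t <= tau ->
    `|mean psi t - mean psi s - mean chi s * (t - s)| <= B * (t - s) ^+ 2 /\
    `|mean chi t - mean chi s| <= B * (t - s).
Proof.
move=> [m1 [C1 C10 l1]] [m2 [C2 C20 l2]] [m3 [C3 C30 l3]] g12 g23.
pose C := C1 + C2 + C3.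
have [le1 le2 le3] : [/\ C1 <= C, C2 <= C & C3 <= C] by rewrite /C; split; lra.
have wid (phi : T -> R) C' : C' <= C ->
    (forall n p, p \in paths n -> `|phi (head f p)| <= C' * n.+1%:R) ->
    (forall n p, p \in paths n -> `|phi (head f p)| <= C * n.+1%:R).
  by move=> CC h n p pn; apply: (le_trans (h n p pn)); rewrite ler_wpM2r.
have C0 : 0 <= C by exact: le_trans le1.
have lip s t : 0 <= s -> s <= t -> t <= tau ->
    `|mean chi t - mean chi s| <= C * growth tau * (t - s).
  move=> s0 st ttau.
  have := @mean_increment chi zeta C 0 (C * growth tau) s t m2 m3 C0
    (wid _ _ le2 l2) (wid _ _ le3 l3) g23 s0 st.
  rewrite mul0r subr0; apply => r sr rt; rewrite subr0.
  apply: (le_trans (mean_norm_le m3 C0 (wid _ _ le3 l3) (le_trans s0 sr))).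
  by rewrite ler_wpM2l// growth_le// (le_trans rt).
exists (C * growth tau) => s t s0 st ttau; split; last exact: lip.
rewrite expr2 mulrA.
apply: (@mean_increment psi chi C) => //; [exact: wid l1|exact: wid l2|].
move=> r sr rt; apply: (le_trans (lip _ _ s0 sr (le_trans rt ttau))).
by rewrite ler_wpM2l ?lerB// mulr_ge0// growth_ge0.
Qed.

Lemma mean_derivative (psi chi zeta : T -> R) :
  observable psi -> observable chi -> observable zeta ->
  is_generator psi chi -> is_generator chi zeta ->
  (forall t, 0 < t -> is_derive t 1 (mean psi) (mean chi t)) /\
  (h^-1 * (mean psi h - mean psi 0) @[h --> 0^'+] --> mean chi 0).
Proof.
move=> o1 o2 o3 g1 g2; split=> [t t0|].
  have [B hB] := mean_C11 (t + 1) o1 o2 o3 g1 g2.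
  by apply: (@increments_is_derive R _ (mean chi) B (t + 1)) => //; rewrite ltrDl.
have [B hB] := mean_C11 1 o1 o2 o3 g1 g2.
apply: (@increments_right_derivative R _ _ B 1) => // h h0 h1.
by have [+ _] := hB 0 h (lexx 0) h0 h1; rewrite subr0.
Qed.

Lemma mean_at0 psi : observable psi -> mean psi 0 = psi f.
Proof.
move=> [m1 [C C0 l1]]; apply/eqP; rewrite -subr_eq0 -normr_le0.
apply: (@le0_of_le_divn _ _ (C * growth 0)) => N.
by have := mean_approx m1 C0 l1 N (lexx 0); rewrite upto_at0.
Qed.

Lemma mean_conserved psi t : observable psi -> is_generator psi (fun=> 0) -> 0 <= t ->
  mean psi t = psi f.
Proof.
move=> o g t0; rewrite -(mean_at0 o); have [m1 [C C0 l1]] := o.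
have mean0 r : mean (fun=> 0) r = 0 by rewrite /mean integral0.
have := @mean_increment psi (fun=> 0) C 0 0 0 t m1 (fun=> measurable_cst _)
  C0 l1 _ g (lexx 0) t0.
rewrite !mul0r !subr0 normr_le0 subr_eq0 => h; apply/eqP; apply: h.
  by move=> n p _; rewrite normr0 mulr_ge0.
by move=> r _ _; rewrite mean0 subrr normr0.
Qed.

(** * Linear combinations of observables *)

Lemma observable_lin a b phi psi : observable phi -> observable psi ->
  observable (fun g => a * phi g + b * psi g).
Proof.
move=> [m1 [C1 C10 l1]] [m2 [C2 C20 l2]]; split.
  by move=> t; apply: measurable_funD; apply: measurable_funM => //; exact: measurable_cst.
exists (`|a| * C1 + `|b| * C2); first by rewrite addr_ge0// mulr_ge0.
move=> n p pn; apply: (le_trans (ler_normD _ _)); rewrite !normrM mulrDl -!mulrA.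
by apply: lerD; rewrite ler_wpM2l//; [exact: l1|exact: l2].
Qed.

Lemma mean_lin a b phi psi t : observable phi -> observable psi -> 0 <= t ->
  mean (fun g => a * phi g + b * psi g) t = a * mean phi t + b * mean psi t.
Proof.
move=> o1 o2 t0; have [m3 [C3 C30 l3]] := observable_lin a b o1 o2.
move: o1 o2 => [m1 [C1 C10 l1]] [m2 [C2 C20 l2]].
have h1 := cvg_mean m1 C10 l1 t0; have h2 := cvg_mean m2 C20 l2 t0.
have h3 := @cvg_mean (fun g => a * phi g + b * psi g) _ m3 C30 l3 t t0.
have h4 : (a * (\sum_(0 <= n < N) level n phi t) + b * (\sum_(0 <= n < N) level n psi t))
    @[N --> \oo] --> a * mean phi t + b * mean psi t.
  by apply: cvgD; apply: cvgM => //; exact: cvg_cst.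
have e : (fun N => \sum_(0 <= n < N) level n (fun g => a * phi g + b * psi g) t) =
    (fun N => a * (\sum_(0 <= n < N) level n phi t) + b * (\sum_(0 <= n < N) level n psi t)).
  apply/funext => N; rewrite !mulr_sumr -big_split/=; apply: eq_bigr => n _.
  by rewrite -!levelZ /level -big_split/=; apply: eq_bigr => p _; rewrite mulrDl.
by rewrite e in h3; exact: (norm_cvg_unique h3 h4).
Qed.

Lemma is_generator_lin a b phi phi' psi psi' :
  is_generator phi phi' -> is_generator psi psi' ->
  is_generator (fun g => a * phi g + b * psi g) (fun g => a * phi' g + b * psi' g).
Proof.
move=> h1 h2 n p pn; rewrite -(h1 n)// -(h2 n)//.
have -> : jump_mean (fun g => a * phi g + b * psi g) (head f p) =
    a * jump_mean phi (head f p) + b * jump_mean psi (head f p).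
  by rewrite /jump_mean !mulr_sumr -big_split/=; apply: eq_bigr => g _; ring.
by ring.
Qed.

Lemma observable0 : observable (fun=> 0).
Proof.
by split=> [t|]; [exact: measurable_cst|exists 0 => // n p _; rewrite normr0 mul0r].
Qed.

Lemma mean0 t : mean (fun=> 0) t = 0.
Proof. by rewrite /mean integral0. Qed.

Lemma is_generator0 : is_generator (fun=> 0) (fun=> 0).
Proof. by move=> n p pn; rewrite (jump_mean_cst _ pn) subrr mulr0. Qed.

Lemma observable_sum (I : eqType) (r : seq I) (c : I -> R) (psi : I -> T -> R) :
  (forall i, i \in r -> observable (psi i)) ->
  observable (fun g => \sum_(i <- r) c i * psi i g).
Proof.
elim: r => [_|i r IH h].
  by rewrite (_ : (fun g => _) = (fun=> 0));
    [exact: observable0|apply/funext => g; rewrite big_nil].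
rewrite (_ : (fun g => _) = (fun g => c i * psi i g + 1 * \sum_(j <- r) c j * psi j g)).
  apply: observable_lin; first by apply: h; rewrite mem_head.
  by apply: IH => j jr; apply: h; rewrite inE jr orbT.
by apply/funext => g; rewrite big_cons mul1r.
Qed.

Lemma mean_sum (I : eqType) (r : seq I) (c : I -> R) (psi : I -> T -> R) t :
  (forall i, i \in r -> observable (psi i)) -> 0 <= t ->
  mean (fun g => \sum_(i <- r) c i * psi i g) t = \sum_(i <- r) c i * mean (psi i) t.
Proof.
move=> + t0; elim: r => [_|i r IH h].
  rewrite big_nil (_ : (fun g => _) = (fun=> 0)) ?mean0//.
  by apply/funext => g; rewrite big_nil.
have hr j : j \in r -> observable (psi j) by move=> jr; apply: h; rewrite inE jr orbT.
rewrite (_ : (fun g => _) = (fun g => c i * psi i g + 1 * \sum_(j <- r) c j * psi j g)).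
  rewrite mean_lin//; last exact: observable_sum.
    by rewrite IH// big_cons mul1r.
  by apply: h; rewrite mem_head.
by apply/funext => g; rewrite big_cons mul1r.
Qed.

Lemma is_generator_sum (I : eqType) (r : seq I) (c : I -> R) (psi chi : I -> T -> R) :
  (forall i, i \in r -> is_generator (psi i) (chi i)) ->
  is_generator (fun g => \sum_(i <- r) c i * psi i g)
    (fun g => \sum_(i <- r) c i * chi i g).
Proof.
elim: r => [_|i r IH h].
  rewrite (_ : (fun g => _) = (fun=> 0)); last by apply/funext => g; rewrite big_nil.
  rewrite (_ : (fun g => _) = (fun=> 0)); last by apply/funext => g; rewrite big_nil.
  exact: is_generator0.
have consE (phi : I -> T -> R) : (fun g => \sum_(j <- i :: r) c j * phi j g) =
    (fun g => c i * phi i g + 1 * \sum_(j <- r) c j * phi j g).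
  by apply/funext => g; rewrite big_cons mul1r.
rewrite !consE; apply: is_generator_lin; first by apply: h; rewrite mem_head.
by apply: IH => j jr; apply: h; rewrite inE jr orbT.
Qed.

End JumpProcess.

(** * The particle system *)

Section FiniteTransitions.
Variables (R : realFieldType) (T I : eqType) (r : seq I) (rate : I -> R) (jump : I -> T).
Variables (g : T) (out : R) (Pi : T -> R).
Hypothesis rate_ge0 : forall i, 0 <= rate i.
Hypothesis outE : out = \sum_(i <- r) (if jump i == g then 0 else rate i).
Hypothesis PiE : forall g', Pi g' =
  if g' == g then (if out == 0 then 1 else 0)
  else (if out == 0 then 0 else (\sum_(i <- r) (if jump i == g' then rate i else 0)) / out).

(** [g] is listed because an absorbing state is its own successor. *)
Let nxt := undup (g :: map jump r).

(** Several transitions may reach the same state and some may fix [g]; the jump chain merges the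
    former and discards the latter. Multiplying by [out] cancels the normalisation, and each target
    splits back into its transitions. *)
Lemma finite_transitions (psi : T -> R) :
  out * (\sum_(g' <- nxt) Pi g' * psi g') =
  \sum_(i <- r) (if jump i == g then 0 else rate i * psi (jump i)).
Proof.
have [z0|z0] := eqVneq out 0.
  rewrite z0 mul0r big_seq big1// => i ir.
  move: (z0) => /eqP; rewrite outE psumr_eq0; last by move=> j _; case: ifP.
  by move=> /allP/(_ _ ir); case: ifP => //= _ /eqP->; rewrite mul0r.
rewrite mulr_sumr.
under eq_bigr => g' _.
  rewrite PiE (negbTE z0).
  rewrite (_ : out * _ = \sum_(i <- r)
    (if g' == g then 0 else if jump i == g' then rate i * psi g' else 0)); last first.
    case: eqP => [_|_]; first by rewrite mul0r mulr0 big1.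
    rewrite mulrA mulrCA divff// mulr1 mulr_suml; apply: eq_bigr => i _.
    by case: ifP; rewrite ?mul0r.
  over.
rewrite exchange_big/=; apply: eq_big_seq => i ir.
rewrite (bigD1_seq (jump i)) ?undup_uniq//=; last first.
  by rewrite mem_undup inE map_f ?orbT.
rewrite eqxx big1 ?addr0// => g' /negbTE gi.
by case: ifP => // _; rewrite eq_sym gi.
Qed.

Lemma finite_transitions_sum : \sum_(g' <- nxt) Pi g' = 1.
Proof.
have [z0|z0] := eqVneq out 0.
  rewrite (bigD1_seq g) ?undup_uniq//=; last by rewrite mem_undup mem_head.
  rewrite PiE eqxx z0 eqxx big1 ?addr0// => g' /negbTE gi.
  by rewrite PiE gi z0 eqxx.
apply: (mulfI z0); have := finite_transitions (fun=> 1).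
under eq_bigr do rewrite mulr1.
move=> ->; rewrite mulr1 outE; apply: eq_bigr => i _.
by case: ifP => //; rewrite mulr1.
Qed.

(** A transition that fixes [g] contributes nothing to a difference, so the discarded ones can be
    put back and the sum runs over all of them. *)
Lemma finite_transitions_generator (psi : T -> R) :
  out * (\sum_(g' <- nxt) Pi g' * psi g' - psi g) =
  \sum_(i <- r) rate i * (psi (jump i) - psi g).
Proof.
rewrite mulrBr finite_transitions outE mulr_suml -sumrB; apply: eq_bigr => i _.
by case: eqP => [->|_]; rewrite ?subrr ?mul0r ?mulr0 ?subrr// mulrBr.
Qed.

End FiniteTransitions.

Lemma esum_finite_supp (R : realType) (I : choiceType) (A : set I) (B : set I)
    (a : I -> R) : finite_set B -> B `<=` A -> (forall i, 0 <= a i) ->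
  (forall i, A i -> ~ B i -> a i = 0) ->
  (\esum_(i in A) (a i)%:E = (\sum_(i <- fset_set B) a i)%:E)%E.
Proof.
move=> fB BA a0 aB; rewrite -sumEFin -fsbig_finite//= -esum_fset//; last first.
  by move=> i _; rewrite lee_fin.
rewrite esum_mkcond [RHS]esum_mkcond; apply: eq_esum => i _.
case: ifPn => [/set_mem Ai|/negP Ai]; case: ifPn => [/set_mem Bi|/negP Bi]//.
  by rewrite aB// => Bi'; apply: Bi; exact: mem_set.
by case: Ai; apply: mem_set; exact: BA.
Qed.

Lemma sum_if_eq (R : ringType) (I : eqType) (s : seq I) (a : I) (F : I -> R) :
  uniq s -> (a \notin s -> F a = 0) ->
  \sum_(i <- s) (if i == a then F i else 0) = F a.
Proof.
move=> us Fa; have [ia|ia] := boolP (a \in s).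
  by rewrite (bigD1_seq a)//= eqxx big1 ?addr0// => i /negbTE ->.
rewrite Fa// big_seq big1// => i si; case: eqP => // ei.
by move: ia; rewrite -ei si.
Qed.

(** * Edge values as signed coordinates along unit vectors *)

Section Graph.
Variables (R : realType) (H : completeNormedModType R) (dot : H -> H -> R).
Variables (V : countType) (pt : V -> H) (nbrs : V -> seq V).
Variables (k : V -> V -> R) (m : V -> R) (V0 : pred V).
Hypothesis hdot : is_hilbert_inner dot.
Hypothesis hG : graph_ok pt nbrs k m.
Local Notation St := (state H V).
Implicit Types (g : St) (x y z : V) (e : V * V).

Lemma dotDl u v w : dot (u + v) w = dot u w + dot v w.
Proof. by case: hdot => _ /(_ 1 u v w) + _ _ _; rewrite scale1r mul1r. Qed.

Lemma dot0l w : dot 0 w = 0.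
Proof. by have := dotDl 0 0 w; rewrite addr0 -[LHS]addr0 => /addrI/esym. Qed.

Lemma dotZl a u w : dot (a *: u) w = a * dot u w.
Proof. by case: hdot => _ /(_ a u 0 w) + _ _ _; rewrite addr0 dot0l addr0. Qed.

Lemma dotNl u w : dot (- u) w = - dot u w.
Proof. by rewrite -scaleN1r dotZl mulN1r. Qed.

Lemma dotC u v : dot u v = dot v u.
Proof. by case: hdot => + _ _ _ _; apply. Qed.

Lemma adjC x y : adj nbrs x y = adj nbrs y x.
Proof. by case: hG => _ [_ [_ [+ _]]]; apply. Qed.

Lemma adj_neq x y : adj nbrs x y -> x != y.
Proof.
case: hG => _ [_ [+ _]] => /(_ x) nx xy; apply: contraNneq nx => yx.
by rewrite -yx in xy.
Qed.

Lemma nbrs_uniq x : uniq (nbrs x).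
Proof. by case: hG => _ [+ _]; apply. Qed.

Lemma k_sym x y : k x y = k y x.
Proof. by case: hG => _ [_ [_ [_ [_ [+ _]]]]] => /(_ x y)[]. Qed.

Lemma k_ge0 x y : 0 <= k x y.
Proof. by case: hG => _ [_ [_ [_ [_ [+ _]]]]] => /(_ x y)[]. Qed.

Lemma m_gt0 x : 0 < m x.
Proof. by case: hG => _ [_ [_ [_ [_ [_ [_ [+ _]]]]]]]; apply. Qed.

Lemma norm_pt_neq0 x y : x != y -> `|pt y - pt x| != 0.
Proof.
case: hG => pti _ xy; rewrite normr_eq0 subr_eq0.
by apply: contra_neq xy => /pti.
Qed.

Lemma evecC x y : evec pt y x = - evec pt x y.
Proof. by rewrite /evec distrC -scalerN opprB. Qed.

Lemma norm_evec x y : x != y -> `|evec pt x y| = 1.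
Proof.
move=> /norm_pt_neq0 h.
by rewrite /evec normrZ normfV normr_id mulVf.
Qed.

Lemma dot_evec x y : x != y -> dot (evec pt x y) (evec pt x y) = 1.
Proof.
move=> /norm_evec h; case: hdot => _ _ p _ /(_ (evec pt x y)); rewrite h => h1.
by rewrite -[LHS]sqr_sqrtr// -h1 expr1n.
Qed.

Lemma edge_valP g x y : in_F pt nbrs g -> adj nbrs x y ->
  exists a : R, [/\ g.2 x y = a *: evec pt x y,
    dot (g.2 x y) (evec pt x y) = a & `|g.2 x y| = `|a|].
Proof.
move=> [_ [_ h]] xy; have [a ga] := h x y xy; have nxy := adj_neq xy.
have ga' : g.2 x y = (a * `|pt y - pt x|) *: evec pt x y.
  by rewrite ga /evec scalerA mulfK// norm_pt_neq0.
exists (a * `|pt y - pt x|); split => //.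
  by rewrite ga' dotZl dot_evec// mulr1.
by rewrite ga' normrZ norm_evec// mulr1.
Qed.

Definition edge_coord x y g : R := dot (g.2 x y) (evec pt x y).

Lemma edge_coordC g x y : in_F pt nbrs g -> edge_coord y x g = - edge_coord x y g.
Proof.
by move=> [gC _]; rewrite /edge_coord gC evecC dotC dotNl dotC.
Qed.

Lemma norm_edge_coord g x y : in_F pt nbrs g -> adj nbrs x y ->
  `|edge_coord x y g| = `|g.2 x y|.
Proof. by move=> gF xy; have [a [_ e1 e2]] := edge_valP gF xy; rewrite /edge_coord e1 e2. Qed.

Lemma sg_edge_coord g x y : in_F pt nbrs g -> adj nbrs x y ->
  `|g.2 x y| * Num.sg (dot (g.2 x y) (evec pt x y)) = edge_coord x y g.
Proof.
by move=> gF xy; have [a [_ e1 e2]] := edge_valP gF xy; rewrite /edge_coord e1 e2 mulrC -numEsg.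
Qed.

(** * Growth of the total mass under a jump *)

Definition mass_le (c : R) g := forall (sx : seq V) (se : seq (V * V)),
  uniq sx -> uniq se -> (forall e, e \in se -> edge_idx nbrs e) ->
  \sum_(x <- sx) `|g.1 x| + \sum_(e <- se) `|g.2 e.1 e.2| <= c.

(** [mass_le] tests all finite families of nodes and of edges counted once, which avoids infinite
    sums. A jump preserves [good] with a larger [c]. *)
Definition good c g := [/\ in_F pt nbrs g,
  finite_set [set x | g.1 x != 0],
  finite_set [set e : V * V | g.2 e.1 e.2 != 0] & mass_le c g].

Definition other x e : V := if e.1 == x then e.2 else e.1.

Definition incident x e : bool := (e.1 == x) || (e.2 == x).

Lemma other_adj x e : edge_idx nbrs e -> incident x e -> adj nbrs x (other x e).
Proof.
case: e => a b /andP[/= ab _]; rewrite /incident /other /=.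
by case: eqP => [<-//|_ /= /eqP <-]; rewrite adjC.
Qed.

(** Each edge is indexed in one orientation only: meeting [x] at opposite ends with the same other
    node would contradict the order given by [pickle]. *)
Lemma other_inj x e e' : edge_idx nbrs e -> edge_idx nbrs e' ->
  incident x e -> incident x e' -> other x e = other x e' -> e = e'.
Proof.
case: e e' => [a b] [a' b'] /andP[/= _ ab] /andP[/= _ ab'].
rewrite /incident /other /=.
have [ea|na] := eqVneq a x; have [ea'|na'] := eqVneq a' x => /=.
- by move=> _ _ ->; rewrite ea ea'.
- move=> _ /eqP eb' eb; move: ab ab'; rewrite ea eb eb' => h1 h2.
  by have := ltn_trans h1 h2; rewrite ltnn.
- move=> /eqP eb _ eb'; move: ab ab'; rewrite ea' eb -eb' => h1 h2.
  by have := ltn_trans h1 h2; rewrite ltnn.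
- by move=> /eqP -> /eqP -> ->.
Qed.

Lemma sum_incident_le x (se : seq (V * V)) : uniq se ->
  (forall e, e \in se -> edge_idx nbrs e) ->
  \sum_(e <- se) (if incident x e then 1 else 0 : R) <= (size (nbrs x))%:R.
Proof.
move=> use hse; rewrite -big_mkcond/= -big_filter.
rewrite big_const_seq count_predT iter_addr_0 ler_nat.
rewrite -(size_map (other x)); apply: uniq_leq_size.
  rewrite map_inj_in_uniq ?filter_uniq// => e e'.
  rewrite !mem_filter => /andP[xe /hse he] /andP[xe' /hse he'].
  exact: other_inj.
move=> y /mapP[e]; rewrite mem_filter => /andP[xe /hse he] ->.
exact: other_adj.
Qed.

Lemma in_F_jump_node g x : in_F pt nbrs g -> in_F pt nbrs (jump_node pt nbrs g x).
Proof.
move=> [gC [g0 gm]]; split; [|split] => a b /=.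
- rewrite (adjC a b) (gC a b) [(a == x) || _]orbC; case: ifP => // /andP[ba].
  have := adj_neq ba.
  have [->|bx] := eqVneq b x; have [->|ax] := eqVneq a x => //=.
- by move=> /negbTE ab; rewrite ab /= g0// ab.
- move=> ab; have [c gc] := gm a b ab; rewrite ab /=; case: ifP; last by exists c.
  have [<- _|ax /= /eqP <-] := eqVneq a x.
    exists (c - Num.sg (g.1 a) * `|pt a - pt b|^-1).
    rewrite gc /evec scalerBl; congr (_ + _); rewrite scalerA -scalerN opprB.
    by [].
  exists (c + Num.sg (g.1 b) * `|pt b - pt a|^-1).
  by rewrite gc /evec scalerDl scalerA.
Qed.

Lemma finite_nbr_edges x : finite_set [set e : V * V | adj nbrs e.1 e.2 && incident x e].
Proof.
apply: (@sub_finite_set _ _ [set` [seq (x, y) | y <- nbrs x] ++ [seq (y, x) | y <- nbrs x]]);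
  last exact: finite_seq.
move=> [a b] /= /andP[ab]; rewrite /incident /= mem_cat => /orP[] /eqP ex.
  by apply/orP; left; apply/mapP; exists b; rewrite -ex.
by apply/orP; right; apply/mapP; exists a; rewrite -ex //; rewrite adjC in ab.
Qed.

(** Every edge at [x] is shifted by a vector of norm at most [1], and there are at most
    [size (nbrs x)] of them. *)
Lemma good_jump_node c g x : good c g ->
  good (c + (size (nbrs x))%:R) (jump_node pt nbrs g x).
Proof.
move=> [gF fx fe gm]; split => //.
- exact: in_F_jump_node.
- apply: (@sub_finite_set _ _ ([set e : V * V | g.2 e.1 e.2 != 0] `|`
    [set e : V * V | adj nbrs e.1 e.2 && incident x e])).
    move=> [a b] /=; rewrite /incident /=; case: ifP => [h _|_ h]; [by right|by left].
  by rewrite finite_setU; split => //; exact: finite_nbr_edges.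
- move=> sx se ux ue he.
  apply: le_trans (lerD (gm sx se ux ue he) (sum_incident_le x ue he)).
  rewrite -addrA lerD2l -big_split/= big_seq [leRHS]big_seq; apply: ler_sum => -[a b] abe.
  rewrite /incident /=; have /andP[/= ab _] := he _ abe; rewrite ab /=.
  case: ifP => h; last by rewrite addr0.
  apply: (le_trans (ler_normD _ _)); rewrite lerD2l normrZ.
  have nab := adj_neq ab.
  have sg1 : `|Num.sg (g.1 x)| <= 1 by rewrite normr_sg; case: (_ != _).
  rewrite norm_evec ?mulr1//; move: h.
  by have [<- _|ax //] := eqVneq a x; rewrite eq_sym.
Qed.

Lemma sum_eq_le1 (s : seq V) x : uniq s ->
  \sum_(y <- s) (if y == x then 1 else 0 : R) <= 1.
Proof.
move=> us; rewrite -big_mkcond/= -big_filter big_const_seq count_predT iter_addr_0.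
by rewrite size_filter -[X in _ <= X]/(1%:R) ler_nat count_uniq_mem// leq_b1.
Qed.

(** The [2] is one unit for each end of the edge. *)
Lemma good_jump_edge c g e : good c g -> good (c + 2) (jump_edge dot pt V0 g e).
Proof.
move=> [gF fx fe gm]; split => //.
- apply: (@sub_finite_set _ _ ([set x | g.1 x != 0] `|` ([set e.1] `|` [set e.2]))).
    move=> x /=; have [->|x1] := eqVneq x e.1; first by right; left.
    have [->|x2] := eqVneq x e.2; first by right; right.
    by rewrite /= subr0 addr0; left.
  rewrite !finite_setU; split => //; split; exact: finite_set1.
- move=> sx se ux ue he.
  apply: le_trans (lerD (gm sx se ux ue he)
    (lerD (sum_eq_le1 e.1 ux) (sum_eq_le1 e.2 ux))).
  rewrite [leRHS]addrAC lerD2r -!big_split/=; apply: ler_sum => x _.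
  set s := Num.sg _.
  have s1 : `|s| <= 1 by rewrite /s normr_sg; case: (_ != _).
  rewrite addrA; apply: (le_trans (ler_normB _ _)); apply: lerD.
    apply: (le_trans (ler_normD _ _)); rewrite lerD2l.
    by case: eqP => //= _; rewrite ?normr0//; case: ifP; rewrite ?normr0.
  by case: eqP => //= _; rewrite ?normr0//; case: ifP; rewrite ?normr0.
Qed.

Lemma good_le c c' g : c <= c' -> good c g -> good c' g.
Proof.
move=> cc [gF fx fe gm]; split => // sx se ux ue he.
exact: le_trans (gm sx se ux ue he) cc.
Qed.

Lemma sum_uniq_le (I : eqType) (s1 s2 : seq I) (F : I -> R) : uniq s1 ->
  (forall i, 0 <= F i) -> (forall i, i \in s1 -> i \notin s2 -> F i = 0) ->
  \sum_(i <- s1) F i <= \sum_(i <- s2) F i.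
Proof.
move=> + F0; elim: s1 s2 => [s2 _ _|i s1 IH s2 /= /andP[is1 us1] h].
  by rewrite big_nil sumr_ge0.
rewrite big_cons; have [is2|is2] := boolP (i \in s2).
  rewrite (perm_big _ (perm_to_rem is2)) big_cons lerD2l; apply: IH => // j js1 jr.
  apply: h; rewrite ?inE ?js1 ?orbT//.
  rewrite (perm_mem (perm_to_rem is2)) inE negb_or jr andbT.
  by apply: contraNneq is1 => <-.
rewrite h ?mem_head// add0r; apply: IH => // j js1; apply: h.
by rewrite inE js1 orbT.
Qed.

Lemma good_init f : in_F0 pt nbrs f -> exists2 c, 0 <= c & good c f.
Proof.
move=> [fF _ _ fx fe].
exists (\sum_(x <- fset_set [set x | f.1 x != 0]) `|f.1 x| +
  \sum_(e <- fset_set [set e : V * V | f.2 e.1 e.2 != 0]) `|f.2 e.1 e.2|).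
  by rewrite addr_ge0// sumr_ge0.
split => // sx se ux ue _; apply: lerD; apply: sum_uniq_le => // i _.
  by rewrite in_fset_set// notin_setE /= => /negP; rewrite negbK => /eqP ->; rewrite normr0.
by rewrite in_fset_set// notin_setE /= => /negP; rewrite negbK => /eqP ->; rewrite normr0.
Qed.

(** * Rates of the particle system as finite sums *)

Definition act_nodes g : seq V := fset_set [set x | g.1 x != 0].

Definition act_edges g : seq (V * V) :=
  fset_set [set e : V * V | edge_idx nbrs e /\ g.2 e.1 e.2 != 0].

Definition transitions g : seq (V + V * V) :=
  map inl (act_nodes g) ++ map inr (act_edges g).

Definition trate g (i : V + V * V) : R :=
  match i with inl x => rate_node m g x | inr e => rate_edge k g e end.

Definition tjump g (i : V + V * V) : St :=
  match i with inl x => jump_node pt nbrs g x | inr e => jump_edge dot pt V0 g e end.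

Definition next_states g : seq St := undup (g :: map (tjump g) (transitions g)).

Lemma trate_ge0 g i : 0 <= trate g i.
Proof.
by case: i => [x|e] /=; rewrite ?divr_ge0 ?mulr_ge0 ?k_ge0// ltW ?m_gt0.
Qed.

Lemma finite_act_edges c g : good c g ->
  finite_set [set e : V * V | edge_idx nbrs e /\ g.2 e.1 e.2 != 0].
Proof. by move=> [_ _ fe _]; apply: sub_finite_set fe => e []. Qed.

Lemma mem_act_edges c g e : good c g ->
  (e \in act_edges g) <-> (edge_idx nbrs e /\ g.2 e.1 e.2 != 0).
Proof.
move=> gd; rewrite /act_edges in_fset_set; last exact: finite_act_edges gd.
by rewrite inE.
Qed.

Lemma mem_act_nodes c g x : good c g -> (x \in act_nodes g) = (g.1 x != 0).
Proof.
move=> [_ fx _ _]; rewrite /act_nodes in_fset_set//.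
by apply/idP/idP; rewrite inE.
Qed.

(** Nodes and edges with value [0] have rate [0], so finite support reduces both infinite sums. The
    filter [b] serves [qout] and [qrate] alike. *)
Lemma esum_transitions c g (b : V + V * V -> bool) : good c g ->
  (\esum_(x in [set: V]) (if b (inl x) then rate_node m g x else 0)%:E +
   \esum_(e in edge_idx nbrs) (if b (inr e) then rate_edge k g e else 0)%:E)%E =
  (\sum_(i <- transitions g) (if b i then trate g i else 0))%:E.
Proof.
move=> gd; have [gF fx fe gm] := gd.
rewrite /transitions big_cat/= !big_map EFinD; congr (_ + _)%E.
  apply: esum_finite_supp => //.
    by move=> x; case: ifP => // _; exact: (trate_ge0 g (inl x)).
  move=> x _ /= /negP; rewrite negbK => /eqP gx.
  by rewrite /rate_node gx normr0 mul0r if_same.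
apply: esum_finite_supp.
- exact: finite_act_edges gd.
- by move=> e [].
- by move=> e; case: ifP => // _; exact: (trate_ge0 g (inr e)).
- move=> e ee /= h; have [ge|ge] := eqVneq (g.2 e.1 e.2) 0.
    by rewrite /rate_edge ge normr0 mulr0 if_same.
  by case: h.
Qed.

Lemma asbool_eq (a b : St) : `[< a = b >] = (a == b).
Proof. by apply/asboolP/eqP. Qed.

Lemma qoutE c g : good c g -> fine (qout dot pt nbrs k m V0 g) =
  \sum_(i <- transitions g) (if tjump g i == g then 0 else trate g i).
Proof.
move=> gd; have := esum_transitions (fun i => tjump g i != g) gd.
rewrite (_ : \sum_(i <- _) _ =
  \sum_(i <- transitions g) (if tjump g i == g then 0 else trate g i)).
  move=> h; rewrite -[RHS]/(fine (_)%:E) -h /qout.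
  congr (fine (_ + _)%E); apply: eq_esum => i _;
  by rewrite asbool_eq /=; case: eqP.
by apply: eq_bigr => i _; case: eqP.
Qed.

Lemma qrateE c g g' : good c g -> fine (qrate dot pt nbrs k m V0 g g') =
  \sum_(i <- transitions g) (if tjump g i == g' then trate g i else 0).
Proof.
move=> gd; have := esum_transitions (fun i => tjump g i == g') gd.
move=> h; rewrite -[RHS]/(fine (_)%:E) -h /qrate.
by congr (fine (_ + _)%E); apply: eq_esum => i _; rewrite asbool_eq.
Qed.

Lemma jumpPE c g g' : good c g -> jumpP dot pt nbrs k m V0 g g' =
  if g' == g then (if fine (qout dot pt nbrs k m V0 g) == 0 then 1 else 0)
  else (if fine (qout dot pt nbrs k m V0 g) == 0 then 0 else
   (\sum_(i <- transitions g) (if tjump g i == g' then trate g i else 0)) /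
   fine (qout dot pt nbrs k m V0 g)).
Proof. by move=> gd; rewrite /jumpP asbool_eq (qrateE _ gd). Qed.

Lemma jumpP_sum c g : good c g ->
  \sum_(g' <- next_states g) jumpP dot pt nbrs k m V0 g g' = 1.
Proof.
move=> gd.
by have := finite_transitions_sum (trate_ge0 g) (qoutE gd) (fun g' => jumpPE g' gd).
Qed.

Lemma jumpP_generator c g (psi : St -> R) : good c g ->
  fine (qout dot pt nbrs k m V0 g) *
    (\sum_(g' <- next_states g) jumpP dot pt nbrs k m V0 g g' * psi g' - psi g) =
  \sum_(i <- transitions g) trate g i * (psi (tjump g i) - psi g).
Proof.
move=> gd.
by have := finite_transitions_generator (trate_ge0 g) (qoutE gd) (fun g' => jumpPE g' gd) psi.
Qed.

Lemma qout_ge0 g : 0 <= fine (qout dot pt nbrs k m V0 g).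
Proof.
apply: fine_ge0; apply: adde_ge0; apply: esum_ge0 => i _; rewrite lee_fin; case: ifP => // _.
  exact: (trate_ge0 g (inl i)).
exact: (trate_ge0 g (inr i)).
Qed.

Lemma jumpP_ge0 g g' : 0 <= jumpP dot pt nbrs k m V0 g g'.
Proof.
rewrite /jumpP; do 2 case: ifP => // _; rewrite ?divr_ge0 ?qout_ge0//.
apply: fine_ge0; apply: adde_ge0; apply: esum_ge0 => i _; rewrite lee_fin; case: ifP => // _.
  exact: (trate_ge0 g (inl i)).
exact: (trate_ge0 g (inr i)).
Qed.

Lemma good_next c (D : nat) g g' : (forall x, (size (nbrs x) <= D)%N) -> good c g ->
  g' \in next_states g -> good (c + (D + 2)%:R) g'.
Proof.
move=> hD gd; rewrite mem_undup inE => /predU1P[->|/mapP[i _ ->]].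
  by apply: good_le gd; rewrite lerDl.
case: i => [x|e] /=.
  by apply: good_le (good_jump_node x gd); rewrite lerD2l ler_nat (leq_trans (hD x))// leq_addr.
by apply: good_le (good_jump_edge e gd); rewrite lerD2l ler_nat leq_addl.
Qed.

(** Each rate is an entry of the mass times a coefficient at most [M]. The absolute value is there
    because an empty graph does not force [M] to be nonnegative. *)
Lemma qout_le M c g : (forall x, (m x)^-1 <= M) ->
  (forall x y, adj nbrs x y -> k x y <= M) -> good c g ->
  fine (qout dot pt nbrs k m V0 g) <= `|M| * c.
Proof.
move=> hm hk gd; have [gF fx fe gm] := gd; rewrite (qoutE gd).
apply: (@le_trans _ _ (\sum_(i <- transitions g) trate g i)).
  by apply: ler_sum => i _; case: ifP => // _; exact: trate_ge0.
have he e : e \in act_edges g -> edge_idx nbrs e.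
  by move=> /(mem_act_edges _ gd)[].
have := gm (act_nodes g) (act_edges g) (fset_uniq _) (fset_uniq _) he.
move=> /(ler_wpM2l (normr_ge0 M)); apply: le_trans.
rewrite big_cat/= !big_map mulrDr !mulr_sumr; apply: lerD.
  apply: ler_sum => x _; rewrite /= /rate_node mulrC ler_wpM2r//.
  exact: le_trans (hm x) (ler_norm _).
rewrite big_seq [leRHS]big_seq; apply: ler_sum => e /he /andP[ae _].
by rewrite /= /rate_edge ler_wpM2r//; exact: le_trans (hk _ _ ae) (ler_norm _).
Qed.

(** * The generator on coordinates *)

Lemma node_coord_le c g x : good c g -> `|g.1 x| <= c.
Proof.
move=> [_ _ _ /(_ [:: x] [::] isT isT)]; rewrite big_seq1 big_nil addr0; apply.
by move=> e.
Qed.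

Lemma edge_coord_le c g x y : good c g -> adj nbrs x y -> `|edge_coord x y g| <= c.
Proof.
move=> gd xy; have [gF _ _ gm] := gd; rewrite norm_edge_coord//.
have one e : edge_idx nbrs e -> `|g.2 e.1 e.2| <= c.
  move=> ee; have := gm [::] [:: e] isT isT; rewrite big_nil big_seq1 add0r; apply.
  by move=> e'; rewrite inE => /eqP ->.
have [lt|gt|/(pcan_inj choice.pickleK) exy] := ltngtP (choice.pickle x) (choice.pickle y).
- by apply: (one (x, y)); apply/andP.
- by case: gF => -> _; apply: (one (y, x)); apply/andP; rewrite adjC.
- by have := adj_neq xy; rewrite exy eqxx.
Qed.

(** Only edge transitions move nodes. Rate times sign is [k] times the edge coordinate, and the
    minus sign at the second end is absorbed by reversing the orientation, so that every edge is
    seen from [x]. *)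
Lemma node_generator c g x : good c g ->
  \sum_(i <- transitions g) trate g i * ((tjump g i).1 x - g.1 x) =
  if V0 x then \sum_(y <- nbrs x) k x y * edge_coord x y g else 0.
Proof.
move=> gd; have [gF fx fe gm] := gd.
rewrite /transitions big_cat/= !big_map /= [X in X + _]big1 ?add0r; last first.
  by move=> z _; rewrite subrr mulr0.
have [x0|x0] := ifP; last first.
  by apply: big1 => e _; rewrite !andbF/= !subr0 addr0 subrr mulr0.
transitivity (\sum_(e <- act_edges g | incident x e)
    k x (other x e) * edge_coord x (other x e) g).
  rewrite [RHS]big_mkcond; apply: eq_big_seq => -[a b] /(mem_act_edges _ gd)[/andP[/= ae le] _].
  rewrite /rate_edge /incident /other /=; set s := Num.sg _.
  have es : `|g.2 a b| * s = edge_coord a b g by exact: sg_edge_coord.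
  have [ea|na] := eqVneq a x.
    have /negbTE nb : x != b by rewrite -ea adj_neq.
    by rewrite nb ?x0 /= subr0 addrAC subrr add0r -mulrA es ea.
  rewrite ?x0 /=; have [eb|nb] := eqVneq b x => /=.
    rewrite addr0 addrAC subrr add0r mulrN -mulrA es.
    by rewrite -eb k_sym (edge_coordC a b)// mulrN.
  by rewrite addr0 subr0 subrr mulr0.
transitivity (\sum_(y <- [seq other x e | e <- act_edges g & incident x e])
    k x y * edge_coord x y g); first by rewrite big_map big_filter.
(* Edges at [x] with value [0] are missing from [act_edges] and contribute nothing; without them
   both sums enumerate the same neighbours. *)
rewrite [RHS](bigID (fun y => g.2 x y == 0))/= [X in X + _]big1 ?add0r; last first.
  by move=> y /eqP gy; rewrite /edge_coord gy dot0l mulr0.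
rewrite -[RHS]big_filter; apply: perm_big; apply: uniq_perm.
- rewrite map_inj_in_uniq ?filter_uniq ?fset_uniq// => e e'.
  rewrite !mem_filter => /andP[xe /(mem_act_edges _ gd)[he _]].
  move=> /andP[xe' /(mem_act_edges _ gd)[he' _]]; exact: other_inj.
- by rewrite filter_uniq// nbrs_uniq.
- move=> y; rewrite mem_filter; apply/mapP/andP.
    move=> [e]; rewrite mem_filter => /andP[xe /(mem_act_edges _ gd)[he ge]] ->.
    split; last exact: other_adj.
    move: xe ge; rewrite /incident /other; case: eqP => [<-//|_ /= /eqP <-].
    by case: gF => ->.
  move=> [gy xy].
  have [lt|gt|/(pcan_inj choice.pickleK) exy] := ltngtP (choice.pickle x) (choice.pickle y).
  + exists (x, y); last by rewrite /other eqxx.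
    rewrite mem_filter /incident eqxx /=; apply/(mem_act_edges _ gd); split => //.
    by apply/andP.
  + exists (y, x).
      rewrite mem_filter /incident eqxx orbT /=; apply/(mem_act_edges _ gd); split.
        by apply/andP; rewrite adjC.
      by case: gF => ->.
    by rewrite /other /=; case: eqP => // yx; rewrite yx in gt *.
  + by have := adj_neq xy; rewrite exy eqxx.
Qed.

(** Only the clocks at the two ends move this edge, each along the unit vector pointing towards the
    firing node; hence the opposite signs. *)
Lemma edge_generator c g x y : good c g -> adj nbrs x y ->
  \sum_(i <- transitions g) trate g i * (edge_coord x y (tjump g i) - edge_coord x y g) =
  g.1 y / m y - g.1 x / m x.
Proof.
move=> gd xy; have [gF fx fe gm] := gd; have nxy := adj_neq xy.
rewrite /transitions big_cat/= !big_map /= [X in _ + X]big1 ?addr0; last first.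
  by move=> e _; rewrite /edge_coord /= subrr mulr0.
have un : uniq (act_nodes g) by exact: fset_uniq.
have h z : z \notin act_nodes g -> g.1 z / m z = 0.
  by rewrite (mem_act_nodes _ gd) negbK => /eqP ->; rewrite mul0r.
have sum1 z : \sum_(i <- act_nodes g) (if i == z then g.1 i / m i else 0) = g.1 z / m z.
  exact: (sum_if_eq (F := fun i => g.1 i / m i) un (h z)).
rewrite -(sum1 y) -(sum1 x) -sumrB; apply: eq_bigr => z _.
have sgz : rate_node m g z * Num.sg (g.1 z) = g.1 z / m z.
  by rewrite /rate_node mulrAC [_ * Num.sg _]mulrC -numEsg.
rewrite /edge_coord /= xy /=; have [zx|zx] := eqVneq z x => /=.
  rewrite zx in sgz *; rewrite (negbTE nxy) sub0r dotDl addrAC subrr add0r dotZl evecC dotNl.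
  by rewrite dot_evec// mulrN1 mulrN sgz.
have [zy|zy] := eqVneq z y => /=.
  rewrite zy in sgz *.
  by rewrite dotDl addrAC subrr add0r dotZl dot_evec// mulr1 sgz subr0.
by rewrite !subrr mulr0.
Qed.

End Graph.

(** * The abstract theory applied to the particle system *)

Lemma good_paths (R : realType) (H : completeNormedModType R) (dot : H -> H -> R)
    (V : countType) (pt : V -> H) (nbrs : V -> seq V) (k : V -> V -> R) (m : V -> R)
    (V0 : pred V) (c : R) (D n : nat) (f : state H V) (p : seq (state H V)) :
  graph_ok pt nbrs k m ->
  (forall x, (size (nbrs x) <= D)%N) -> 0 <= c -> good pt nbrs c f ->
  p \in paths f (next_states dot pt nbrs V0) n ->
  good pt nbrs ((c + (D + 2)%:R) * n.+1%:R) (head f p).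
Proof.
move=> hG hD c0 gf.
suff h : forall q, q \in paths f (next_states dot pt nbrs V0) n ->
    good pt nbrs (c + (D + 2)%:R * n%:R) (head f q).
  move=> /h; apply: good_le; rewrite mulrDl; apply: lerD.
    by rewrite ler_peMr// ler1n.
  by rewrite ler_wpM2l// ler_nat.
elim: n => [|n IH] q /=; first by rewrite inE => /eqP -> /=; rewrite mulr0 addr0.
move=> /allpairsPdep[q' [g [/IH gq' gn ->]]] /=.
apply: good_le (good_next hG hD gq' gn).
by rewrite -[n.+1%:R]natr1 mulrDr mulr1 addrA.
Qed.

Theorem theorem3p2 (R : realType) (H : completeNormedModType R)
  (dot : H -> H -> R) (V : countType) (pt : V -> H) (nbrs : V -> seq V)
  (k : V -> V -> R) (m : V -> R) (V0 : pred V)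
  (hdot : is_hilbert_inner dot)
  (hG : graph_ok pt nbrs k m)
  (f : state H V) (hf : in_F0 pt nbrs f)
  (d : measure_display) (Omega : measurableType d) (P : probability Omega R)
  (Y : nat -> Omega -> state H V) (S : nat -> Omega -> \bar R)
  (X : R -> Omega -> state H V)
  (hX : is_IPS dot pt nbrs k m V0 P f Y S X) :
  (* integrability of f_t(xi), so that the means are finite *)
  (forall (t : R) x, 0 <= t -> P.-integrable setT (fun w => ((X t w).1 x)%:E)) /\
  (forall (t : R) x y, 0 <= t -> adj nbrs x y ->
     P.-integrable setT (fun w => (dot ((X t w).2 x y) (evec pt x y))%:E)) /\
  (* initial condition *)
  (forall x, meanN P X x 0 = f.1 x) /\
  (forall x y, adj nbrs x y ->
     meanE dot pt P X x y 0 = dot (f.2 x y) (evec pt x y)) /\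
  (* boundary condition on V1 *)
  (forall x (t : R), ~~ V0 x -> 0 <= t -> meanN P X x t = f.1 x) /\
  (* node equations, x in V0: two-sided derivative at t > 0, right derivative at 0 *)
  (forall x, V0 x ->
     (forall t : R, 0 < t ->
        is_derive t 1 (meanN P X x)
          (\sum_(y <- nbrs x) k x y * meanE dot pt P X x y t)) /\
     (h^-1 * (meanN P X x h - meanN P X x 0) @[h --> 0^'+] -->
          \sum_(y <- nbrs x) k x y * meanE dot pt P X x y 0)) /\
  (* edge equations *)
  (forall x y, adj nbrs x y ->
     (forall t : R, 0 < t ->
        is_derive t 1 (meanE dot pt P X x y)
          (meanN P X y t / m y - meanN P X x t / m x)) /\
     (h^-1 * (meanE dot pt P X x y h - meanE dot pt P X x y 0) @[h --> 0^'+] -->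
          meanN P X y 0 / m y - meanN P X x 0 / m x)).
Proof.
have [_ [_ [_ [_ [[D hD] [_ [_ [_ [M [hm hk]]]]]]]]]] := hG.
have [c c0 gf] := good_init hf.
have [mY [mS [law [XJ [mN mE]]]]] := hX.
set C := c + (D + 2)%:R.
have C0 : 0 <= C by rewrite addr_ge0.
pose Q g := fine (qout dot pt nbrs k m V0 g).
pose Pj := jumpP dot pt nbrs k m V0.
pose nx := next_states dot pt nbrs V0.
have gp n p : p \in paths f nx n -> good pt nbrs (C * n.+1%:R) (head f p).
  exact: (good_paths hG hD c0 gf).
have Q0 g : 0 <= Q g by exact: (qout_ge0 _ _ hG).
have P0 g g' : 0 <= Pj g g' by exact: (jumpP_ge0 _ _ hG).
have nu g : uniq (nx g) by exact: undup_uniq.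
have PS n p : p \in paths f nx n -> \sum_(g <- nx (head f p)) Pj (head f p) g = 1.
  by move=> /gp gd; exact: (jumpP_sum dot V0 hG gd).
have Qle n p : p \in paths f nx n -> Q (head f p) <= (`|M| * C) * n.+1%:R.
  by move=> /gp gd; rewrite -mulrA; exact: (qout_le _ _ hG hm hk gd).
pose node x (g : state H V) : R := g.1 x.
pose edge x y (g : state H V) : R := edge_coord dot pt x y g.
have oN x : observable f nx X (node x).
  split=> [t|]; first exact: mN.
  by exists C => // n p /gp gd; exact: node_coord_le gd.
have oE x y : adj nbrs x y -> observable f nx X (edge x y).
  move=> xy; split=> [t|]; first exact: mE.
  by exists C => // n p /gp gd; exact: (edge_coord_le hdot hG gd xy).
(* [dnode] and [dedge] are the two halves of the operator; being finite combinations of coordinates,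
   they are observables to which the generator applies again. *)
pose dnode x g := \sum_(y <- nbrs x) k x y * edge x y g.
pose dedge x y g := (m y)^-1 * node y g + (- (m x)^-1) * node x g.
have odN x : observable f nx X (dnode x).
  by apply: observable_sum => y xy; exact: oE.
have odE x y : observable f nx X (dedge x y) by exact: observable_lin.
have gN x : is_generator f Q Pj nx (node x) (fun g => if V0 x then dnode x g else 0).
  move=> n p /gp gd; rewrite /jump_mean /nx (jumpP_generator _ _ hG (node x) gd).
  by rewrite /node (node_generator V0 hdot hG x gd).
have gE x y : adj nbrs x y -> is_generator f Q Pj nx (edge x y) (dedge x y).
  move=> xy n p /gp gd; rewrite /jump_mean /nx (jumpP_generator _ _ hG (edge x y) gd).
  rewrite /edge (edge_generator V0 hdot hG gd xy) /dedge /node.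
  by rewrite mulNr ![_^-1 * _]mulrC.
have gdN x : is_generator f Q Pj nx (dnode x)
    (fun g => \sum_(y <- nbrs x) k x y * dedge x y g).
  by apply: (is_generator_sum PS) => y xy; exact: gE.
have meanN_E x : meanN P X x = mean P X (node x) by [].
have meanE_E x y : meanE dot pt P X x y = mean P X (edge x y) by [].
have mean_dN x t : 0 <= t -> mean P X (dnode x) t =
    \sum_(y <- nbrs x) k x y * meanE dot pt P X x y t.
  by move=> t0; apply: (mean_sum mY mS law Q0 P0 nu PS Qle XJ) => // y xy; exact: oE.
have mean_dE x y t : 0 <= t -> mean P X (dedge x y) t =
    meanN P X y t / m y - meanN P X x t / m x.
  move=> t0; rewrite (mean_lin mY mS law Q0 P0 nu PS Qle XJ)//.
  by rewrite mulNr ![_^-1 * _]mulrC.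
do 6?split.
- move=> t x t0; have [mo [B B0 lB]] := oN x.
  exact: (integrable_observable mY mS law Q0 P0 nu PS Qle XJ mo B0 lB t0).
- move=> t x y t0 xy; have [mo [B B0 lB]] := oE x y xy.
  exact: (integrable_observable mY mS law Q0 P0 nu PS Qle XJ mo B0 lB t0).
- by move=> x; exact: (mean_at0 mY mS law Q0 P0 nu PS Qle XJ (oN x)).
- by move=> x y xy; exact: (mean_at0 mY mS law Q0 P0 nu PS Qle XJ (oE x y xy)).
- move=> x t x1 t0; apply: (mean_conserved mY mS law Q0 P0 nu PS Qle XJ (oN x)) => //.
  by have := gN x; rewrite (negbTE x1).
- move=> x x0; have gNx : is_generator f Q Pj nx (node x) (dnode x).
    by have := gN x; rewrite x0.
  have o2 : observable f nx X (fun g => \sum_(y <- nbrs x) k x y * dedge x y g).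
    by apply: observable_sum => y _; exact: odE.
  have [h1 h2] := mean_derivative mY mS law Q0 P0 nu PS Qle XJ (oN x) (odN x) o2 gNx (gdN x).
  rewrite -mean_dN//; split=> [t t0|]; last exact: h2.
  by rewrite -mean_dN ?(ltW t0)//; exact: h1.
- move=> x y xy.
  (* An end of the edge may lie outside [V0]; its value is frozen, so the second application of the
     generator gives [0] there. *)
  pose ndnode z g := if V0 z then dnode z g else 0.
  have ond z : observable f nx X (ndnode z).
    by rewrite /ndnode; case: (V0 z); [exact: odN|exact: observable0].
  have o2 : observable f nx X (fun g => (m y)^-1 * ndnode y g + (- (m x)^-1) * ndnode x g).
    exact: observable_lin.
  have gdE : is_generator f Q Pj nx (dedge x y)
      (fun g => (m y)^-1 * ndnode y g + (- (m x)^-1) * ndnode x g).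
    by apply: is_generator_lin; exact: gN.
  have [h1 h2] := mean_derivative mY mS law Q0 P0 nu PS Qle XJ (oE x y xy)
    (odE x y) o2 (gE x y xy) gdE.
  rewrite -mean_dE//; split=> [t t0|]; last exact: h2.
  by rewrite -mean_dE ?(ltW t0)//; exact: h1.
Qed.
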